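(* Let $\mathcal I$ be a thick masure of finite thickness of type $\mathbb A$ with a strongly transitive group $G$, as described in the context. Let $\mu\in\mathbb A$. (1) If $\mu\notin Q^\vee_{\mathbb R_-}$, then $\rho_{+\infty}^{-1}(\{\lambda+\mu\})\cap\rho_{-\infty}^{-1}(\{\lambda\})$ is empty for all $\lambda\in\mathbb A$. (2) If $\mu\in Q^\vee_{\mathbb R_-}$, then for $\lambda\in\mathbb A$ sufficiently dominant, $$\rho_{+\infty}^{-1}(\{\lambda+\mu\})\cap\rho_{-\infty}^{-1}(\{\lambda\})\subset S^v(0,\lambda)\cap\rho_{+\infty}^{-1}(\{\lambda+\mu\}).$$
   Context: **Root data.** Let $I$ be a finite set and $C=(c_{i,j})_{i,j\in I}$ a generalized Cartan (Kac-Moody) matrix: integer entries, $c_{i,i}=2$, $c_{i,j}\le 0$ for $i\ne j$, $c_{i,j}=0\Leftrightarrow c_{j,i}=0$. Let $(C,X,Y,(\alpha_i)_{i\in I},(\alpha_i^\vee)_{i\in I})$ be a root generating system: $X,Y$ are dual free $\mathbb Z$-modules of finite rank, $(\alpha_i)$ is a free family in $X$, $(\alpha_i^\vee)$ is a free family in $Y$, and $c_{i,j}=\alpha_j(\alpha_i^\vee)$. Let $V=Y\otimes\mathbb R$; elements of $X$ are viewed as linear forms on $V$. Let $r_i(v)=v-\alpha_i(v)\alpha_i^\vee$ and let $W^v\subset \mathrm{GL}(V)$ be generated by the $r_i$; it acts on $V^*$ by $(w.\alpha)(x)=\alpha(w^{-1}.x)$. Let $\Phi=\{w.\alpha_i\}$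 be the real roots and $\Delta\supset\Phi$ the set of all roots (real and imaginary) of the Kac-Moody algebra of $C$, viewed in $\bigoplus_i\mathbb Z\alpha_i$. Put $Q^\vee=\bigoplus_i\mathbb Z\alpha_i^\vee$, $W^a=Q^\vee\rtimes W^v$ (affine Weyl group), $Q^\vee_{\mathbb R_+}=\bigoplus_i\mathbb R_+\alpha_i^\vee$, $Q^\vee_{\mathbb R_-}=-Q^\vee_{\mathbb R_+}$. **Cones.** $C^v_f=\{v\in V\mid\alpha_i(v)>0\ \forall i\in I\}$, with closure $\overline{C^v_f}$. For $J\subset I$, $F^v(J)=\{v\mid\alpha_i(v)=0\ \forall i\in J,\ \alpha_i(v)>0\ \forall i\in I\setminus J\}$. Vectorial faces are the sets $\pm w.F^v(J)$, $w\in W^v$. The Tits cone is $\mathcal T=\bigcup_{w\in W^v}w.\overline{C^v_f}$, with interior $\mathring{\mathcal T}$; a vectorial face is spherical if it meets $\mathring{\mathcal T}\cup-\mathring{\mathcal T}$. Write $x\le y$ if $y-x\in\mathcal T$. For $x\in\mathcal T$, $x^{++}$ is the unique element of $W^v.x\cap\overline{C^v_f}$. A ray with base point $x$ containing $y\neq x$, or an interval $[x,y]$, is preordered if $x\le y$ or $y\le x$, and generic if $y-x\in\pm\mathring{\mathcal T}$. **Filters.** A filter on a set $E$ is a nonempty set of nonempty subsets of $E$ stable under finite intersections and supersets. A nonempty subset of $E$ is identified with the filter of its supersets. A set contains a filter if it is an element of it (contains one of its elements); a map fixes a filter if it fixes pointwise at least one element of it. $F\subset F'$ means every element of $F'$ is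 an element of $F$; the union of two filters consists of the sets belonging to both. The closure of a filter is the filter of sets containing the closure of one of its elements. The germ $germ_x(\Omega)$ of $\Omega\subset V$ at $x\in\overline\Omega$ is the filter of sets containing a neighbourhood of $x$ in $\Omega$; the germ of a preordered interval $[x,y]$ is $germ_x([x,y])$. A sector is a set $x\pm w.C^v_f$; its sector-germ is the filter of subsets of $V$ containing a translate of it. $+\infty$ (resp. $-\infty$) is the sector-germ of $C^v_f$ (resp. $-C^v_f$). **Enclosures, faces, chimneys.** For $\alpha\in\Delta$, $k\in\mathbb Z$, let $D(\alpha,k)=\{v\mid\alpha(v)+k\ge0\}$, $D^\circ(\alpha,k)=\{v\mid\alpha(v)+k>0\}$, $D(\alpha,+\infty)=V$. The enclosure $\mathrm{cl}(F)$ of a filter $F$ on $V$ is the filter of sets containing an element of $F$ of the form $\bigcap_{\alpha\in\Delta}D(\alpha,k_\alpha)$, $k_\alpha\in\mathbb Z\cup\{+\infty\}$. For $x\in V$ and a vectorial face $F^v$, the face $F(x,F^v)$ is the filter of sets containing an intersection of half-spaces $D(\alpha,k_\alpha)$ or $D^\circ(\alpha,k_\alpha)$ ($k_\alpha\in\mathbb Z$, $\alpha\in\Delta$) that contains $\Omega\cap(x+F^v)$ for some open neighbourhood $\Omega$ of $x$. Faces are ordered by $F\le F'\Leftrightarrow F\subset\overline{F'}$; the support of a filter is the smallest affine subspace containing it. A face is spherical if the direction of its support meets $\pm\mathring{\mathcal T}$. A chamber is a maximal face; a panel is a spherical face maximal among faces that are not chambers. The chimney with basis $F=F(x,F_0^v)$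 and direction $F^v$ is $\mathfrak r(F,F^v)=\mathrm{cl}(F+F^v)$; it is splayed if $F^v$ is spherical, solid if the pointwise stabilizer in $W^v$ of (the direction of) its support is finite. A shortening is $\mathfrak r(F(x+\xi,F_0^v),F^v)$ with $\xi\in\overline{F^v}$; the germ of a chimney is the filter of sets containing a shortening. A sector is a splayed solid chimney and its germ is its sector-germ. **Masures.** $\mathbb A$ denotes the affine space $V$ with all this structure. An apartment of type $\mathbb A$ is a set $A$ with a nonempty set $\mathrm{Isom}(\mathbb A,A)$ of bijections such that, for $f_0\in\mathrm{Isom}(\mathbb A,A)$, $f\in\mathrm{Isom}(\mathbb A,A)$ iff $f=f_0\circ w$ for some $w\in W^a$. An isomorphism of apartments $\phi:A\to A'$ is a bijection with $f\in \mathrm{Isom}(\mathbb A,A)\Leftrightarrow\phi\circ f\in\mathrm{Isom}(\mathbb A,A')$. All $W^a$-invariant notions transfer to apartments. A masure of type $\mathbb A$ is a set $\mathcal I$ covered by a set $\mathcal A$ of subsets, called apartments, with: (MA1) each $A\in\mathcal A$ has a structure of apartment of type $\mathbb A$. (MA2) If $F$ is a point, a germ of a preordered interval, a generic ray or a solid chimney in an apartment $A$ and $A'$ is another apartment containing $F$, then $A\cap A'$ contains $\mathrm{cl}_A(F)$ and there is an isomorphism $A\to A'$ fixing $\mathrm{cl}_A(F)$. (MA3) If $\mathfrak R$ is the germ of a splayed chimney and $F$ is a face or a germ of a solid chimney, some apartment contains $\mathfrak R$ and $F$. (MA4) If two apartments $A,A'$ contain $\mathfrak R$ and $F$ as in (MA3),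 there is an isomorphism $A\to A'$ fixing $\mathrm{cl}_A(\mathfrak R\cup F)$. (MAO) If $x,y$ lie in two apartments $A,A'$ and $x\le_A y$, then the segments $[x,y]_A$ and $[x,y]_{A'}$ are equal. **Standing assumptions.** $\mathcal I$ is a masure, thick of finite thickness (the number of chambers containing a given panel is finite and at least $3$). $G$ is a strongly transitive group of automorphisms of $\mathcal I$ (it permutes the apartments and transports their structure, and all isomorphisms in the axioms are induced by elements of $G$). A fundamental apartment is fixed and identified with $\mathbb A$ (with origin $0$); the apartments are the sets $g.\mathbb A$, $g\in G$. The stabilizer $N$ of $\mathbb A$ in $G$ induces on $\mathbb A$ the group $W^v\ltimes Y$. **Retractions and vectorial distance.** For $x\in\mathcal I$ there is an apartment $B$ containing $x$ and $+\infty$ and an isomorphism $\phi:B\to\mathbb A$ fixing $+\infty$; $\rho_{+\infty}(x)=\phi(x)$ is independent of choices. $\rho_{-\infty}:\mathcal I\to\mathbb A$ is defined likewise with $-\infty$. For $x,y\in\mathcal I$, $x\le y$ means $x\le_A y$ for some (equivalently any) apartment $A$ containing $x,y$ (at least one such apartment existing). If $x\le y$, $d^v(x,y)=(g.y-g.x)^{++}\in\overline{C^v_f}$ for any $g\in G$ with $g.x,g.y\in\mathbb A$ (independent of choices). $S^v(x,\lambda)=\{y\in\mathcal I\mid x\le y,\ d^v(x,y)=\lambda\}$. **Convention.** ''For $\lambda\in E$ sufficiently dominant, $P(\lambda)$'' means: there is a real $M$ (depending on $\mu$) such that $P(\lambda)$ holds for every $\lambda\in E$ with $\alpha_i(\lambda)\ge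 M$ for all $i\in I$. *)

(* Defs.v *)
From HB Require Import structures.
From mathcomp Require Import all_boot all_order all_algebra.
From mathcomp Require Import all_classical all_reals all_analysis.
From mathcomp Require Import complex.

Set Implicit Arguments.
Unset Strict Implicit.
Unset Printing Implicit Defensive.

Import Order.TTheory GRing.Theory Num.Theory.
Import numFieldNormedType.Exports.

Local Open Scope classical_set_scope.
Local Open Scope ring_scope.

(* A pair of dual free Z-modules X, Y of rank n is given by dual bases, so
   X and Y are both 'rV[int]_n and the duality is the dot product; Y (x) K is
   'rV[K]_n and an element of X is a linear form on it. *)
Definition pairing (K : pzRingType) (n : nat) (x : 'rV[int]_n) (v : 'rV[K]_n) : K :=
  \sum_(k < n) (x 0 k)%:~R * v 0 k.

Definition ofY (K : pzRingType) (n : nat) (y : 'rV[int]_n) : 'rV[K]_n :=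
  map_mx (fun z : int => z%:~R) y.

Definition Zfree (I : finType) (n : nat) (a : I -> 'rV[int]_n) : Prop :=
  forall c : I -> int, \sum_i c i *: a i = 0 -> forall i, c i = 0.

Record root_generating_system (I : finType) (n : nat) := RootGeneratingSystem {
  gcm : I -> I -> int;
  sroot : I -> 'rV[int]_n;
  scoroot : I -> 'rV[int]_n;
  gcm_diag : forall i, gcm i i = 2;
  gcm_offdiag : forall i j, i != j -> gcm i j <= 0;
  gcm_eq0 : forall i j, gcm i j = 0 <-> gcm j i = 0;
  sroot_free : Zfree sroot;
  scoroot_free : Zfree scoroot;
  gcmE : forall i j, gcm i j = pairing (sroot j) (scoroot i)
}.

(* The Kac-Moody algebra over a field K, with Cartan subalgebra Y (x) K, by
   generators and relations (those of Chevalley and Serre): it is the quotient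
   of km_term by km_eq. *)
Section KacMoodyAlgebra.
Context (K : fieldType) (I : finType) (n : nat) (D : root_generating_system I n).

Inductive km_term : Type :=
| KMe of I
| KMf of I
| KMh of 'rV[K]_n
| KMadd of km_term & km_term
| KMscale of K & km_term
| KMbr of km_term & km_term.

Definition km_zero : km_term := KMh 0.

(* For j != i, 1 - c_ij >= 1, so the absolute value is harmless. *)
Definition km_serre (g : I -> km_term) (i j : I) : km_term :=
  iter `|1 - gcm D i j|%N (KMbr (g i)) (g j).

Inductive km_eq : km_term -> km_term -> Prop :=
| km_refl x : km_eq x x
| km_sym x y : km_eq x y -> km_eq y x
| km_trans x y z : km_eq x y -> km_eq y z -> km_eq x z
| km_addE x x' y y' : km_eq x x' -> km_eq y y' -> km_eq (KMadd x y) (KMadd x' y')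
| km_scaleE a x x' : km_eq x x' -> km_eq (KMscale a x) (KMscale a x')
| km_brE x x' y y' : km_eq x x' -> km_eq y y' -> km_eq (KMbr x y) (KMbr x' y')
| km_addC x y : km_eq (KMadd x y) (KMadd y x)
| km_addA x y z : km_eq (KMadd x (KMadd y z)) (KMadd (KMadd x y) z)
| km_add0 x : km_eq (KMadd km_zero x) x
| km_scale0 x : km_eq (KMscale 0 x) km_zero
| km_scale1 x : km_eq (KMscale 1 x) x
| km_scaleA a b x : km_eq (KMscale a (KMscale b x)) (KMscale (a * b) x)
| km_scaleDl a b x : km_eq (KMscale (a + b) x) (KMadd (KMscale a x) (KMscale b x))
| km_scaleDr a x y : km_eq (KMscale a (KMadd x y)) (KMadd (KMscale a x) (KMscale a y))
| km_brDl x y z : km_eq (KMbr (KMadd x y) z) (KMadd (KMbr x z) (KMbr y z))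
| km_brDr x y z : km_eq (KMbr x (KMadd y z)) (KMadd (KMbr x y) (KMbr x z))
| km_brZl a x y : km_eq (KMbr (KMscale a x) y) (KMscale a (KMbr x y))
| km_brZr a x y : km_eq (KMbr x (KMscale a y)) (KMscale a (KMbr x y))
| km_brxx x : km_eq (KMbr x x) km_zero
| km_jacobi x y z :
    km_eq (KMadd (KMbr x (KMbr y z)) (KMadd (KMbr y (KMbr z x)) (KMbr z (KMbr x y))))
          km_zero
| km_hD h h' : km_eq (KMh (h + h')) (KMadd (KMh h) (KMh h'))
| km_hZ a h : km_eq (KMh (a *: h)) (KMscale a (KMh h))
| km_hh h h' : km_eq (KMbr (KMh h) (KMh h')) km_zero
| km_he h i : km_eq (KMbr (KMh h) (KMe i)) (KMscale (pairing (sroot D i) h) (KMe i))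
| km_hf h i : km_eq (KMbr (KMh h) (KMf i)) (KMscale (- pairing (sroot D i) h) (KMf i))
| km_ef i : km_eq (KMbr (KMe i) (KMf i)) (KMh (ofY K (scoroot D i)))
| km_ef0 i j : i != j -> km_eq (KMbr (KMe i) (KMf j)) km_zero
| km_serre_e i j : i != j -> km_eq (km_serre KMe i j) km_zero
| km_serre_f i j : i != j -> km_eq (km_serre KMf i j) km_zero.

(* An element of the root lattice is given by its coordinates in the basis
   (alpha_i). *)
Definition root_form (c : {ffun I -> int}) (v : 'rV[K]_n) : K :=
  \sum_i (c i)%:~R * pairing (sroot D i) v.

Definition km_root (c : {ffun I -> int}) : Prop :=
  c <> [ffun=> 0] /\
  exists x : km_term,
    (forall h, km_eq (KMbr (KMh h) x) (KMscale (root_form c h) x)) /\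
    ~ km_eq x km_zero.

End KacMoodyAlgebra.

Section Apartment.
Context (R : realType) (I : finType) (n : nat) (D : root_generating_system I n).
Local Notation V := 'rV[R]_n.

Definition alpha (i : I) (v : V) : R := pairing (sroot D i) v.
Definition coroot (i : I) : V := ofY R (scoroot D i).

Definition refl (i : I) (v : V) : V := v - alpha i v *: coroot i.

(* The r_i are involutions, so the group they generate is the set of words. *)
Definition weyl_word (s : seq I) (v : V) : V := foldr refl v s.
Definition weyl : set (V -> V) := range weyl_word.

Definition real_root (c : {ffun I -> int}) : Prop :=
  exists w i, weyl w /\ forall v, root_form D c (w v) = alpha i v.

(* An imaginary root is a root of the complex Kac-Moody algebra which is not
   real; the real roots are known to be roots of that algebra. *)
Definition imaginary_root (c : {ffun I -> int}) : Prop :=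
  km_root R[i] D c /\ ~ real_root c.

Definition Delta : set {ffun I -> int} :=
  [set c | real_root c \/ imaginary_root c].

Definition in_Qvee (v : V) : Prop :=
  exists c : I -> int, v = \sum_i (c i)%:~R *: coroot i.

Definition affine_weyl : set (V -> V) :=
  [set f | exists w q, [/\ weyl w, in_Qvee q & f = (fun v => w v + q)]].

Definition weyl_Y : set (V -> V) :=
  [set f | exists w (y : 'rV[int]_n), weyl w /\ f = (fun v => w v + ofY R y)].

Definition Qvee_pos : set V :=
  [set v | exists c : I -> R, (forall i, 0 <= c i) /\ v = \sum_i c i *: coroot i].
Definition Qvee_neg : set V := [set v | Qvee_pos (- v)].

Definition opps (S : set V) : set V := [set - v | v in S].

Definition Cvf : set V := [set v | forall i, 0 < alpha i v].

Definition Fvf (J : {set I}) : set V :=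
  [set v | (forall i, i \in J -> alpha i v = 0) /\
           (forall i, i \notin J -> 0 < alpha i v)].

Definition vface (F : set V) : Prop :=
  exists w J, weyl w /\ (F = w @` Fvf J \/ F = opps (w @` Fvf J)).

Definition tits : set V := [set v | exists w, weyl w /\ (w @` closure Cvf) v].

Definition tits_int : set V := [set v | interior tits v \/ opps (interior tits) v].

Definition spherical_vface (F : set V) : Prop := F `&` tits_int !=set0.

Definition vle (x y : V) : Prop := tits (y - x).

Definition pp (x : V) : V :=
  xget 0 [set l | closure Cvf l /\ exists w, weyl w /\ l = w x].

Definition segment (x y : V) : set V :=
  [set z | exists t : R, 0 <= t <= 1 /\ z = x + t *: (y - x)].

Definition ray (x y : V) : set V :=
  [set z | exists t : R, 0 <= t /\ z = x + t *: (y - x)].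

Definition germ (x : V) (Omega : set V) : set_system V := within Omega (nbhs x).

Definition sector_germ (C : set V) : set_system V :=
  [set S | exists x, [set x + v | v in C] `<=` S].
Definition pinfty : set_system V := sector_germ Cvf.
Definition minfty : set_system V := sector_germ (opps Cvf).

Definition halfspace (c : {ffun I -> int}) (k : int) : set V :=
  [set v | 0 <= root_form D c v + k%:~R].
Definition open_halfspace (c : {ffun I -> int}) (k : int) : set V :=
  [set v | 0 < root_form D c v + k%:~R].

(* [None] stands for k = +oo. *)
Definition halfspace_ext (c : {ffun I -> int}) (k : option int) : set V :=
  if k is Some k' then halfspace c k' else setT.

Definition cl (F : set_system V) : set_system V :=
  [set S | exists k : {ffun I -> int} -> option int,
     let E := [set v | forall c, Delta c -> halfspace_ext c (k c) v] in
     F E /\ E `<=` S].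

Definition is_halfspace (H : set V) : Prop :=
  exists c k, Delta c /\ (H = halfspace c k \/ H = open_halfspace c k).

Definition lface (x : V) (Fv : set V) : set_system V :=
  [set S | exists HH : set (set V),
     [/\ HH `<=` is_halfspace,
         exists Omega, open_nbhs x Omega /\
           Omega `&` [set x + v | v in Fv] `<=` \bigcap_(H in HH) H
       & \bigcap_(H in HH) H `<=` S]].

Definition face (F : set_system V) : Prop :=
  exists x Fv, vface Fv /\ F = lface x Fv.

Definition filter_closure (F : set_system V) : set_system V :=
  [set S | exists2 A, F A & closure A `<=` S].

(* F is included in F' as filters when every element of F' is one of F. *)
Definition face_le (F F' : set_system V) : Prop := filter_closure F' `<=` F.

Definition affine_subspace (E : set V) : Prop :=
  forall x y (t : R), E x -> E y -> E (x + t *: (y - x)).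

(* Affine subspaces containing a filter are stable under intersection (finite
   dimension), hence this is the smallest of them. *)
Definition support (F : set_system V) : set V :=
  [set v | forall E, affine_subspace E -> F E -> E v].

Definition support_dir (F : set_system V) : set V :=
  [set d | exists x y, [/\ support F x, support F y & d = y - x]].

Definition spherical_face (F : set_system V) : Prop :=
  face F /\ support_dir F `&` tits_int !=set0.

Definition chamber (F : set_system V) : Prop :=
  face F /\ forall F', face F' -> face_le F F' -> F' = F.

Definition panel (F : set_system V) : Prop :=
  [/\ spherical_face F, ~ chamber F &
      forall F', face F' -> ~ chamber F' -> face_le F F' -> F' = F].

Definition filter_add (F : set_system V) (B : set V) : set_system V :=
  [set S | exists2 A, F A & forall a b, A a -> B b -> S (a + b)].

Definition chimney (x : V) (F0 Fv : set V) : set_system V :=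
  cl (filter_add (lface x F0) Fv).

Definition solid (x : V) (F0 Fv : set V) : Prop :=
  finite_set [set w | weyl w /\ forall d, support_dir (chimney x F0 Fv) d -> w d = d].

Definition chimney_germ (x : V) (F0 Fv : set V) : set_system V :=
  [set S | exists2 xi, closure Fv xi & chimney (x + xi) F0 Fv S].

End Apartment.

(* Filters of an apartment A are read on the whole set T, as images of filters
   of V by an element of Isom(V,A); thus the filters carried by two apartments
   can be compared, and A contains a filter F iff F A. *)
Record masure_data (R : realType) (n : nat) (T : Type) := MasureData {
  apt : set (set T);
  isom : set T -> set ('rV[R]_n -> T)
}.

Section Masure.
Context (R : realType) (I : finType) (n : nat) (D : root_generating_system I n).
Local Notation V := 'rV[R]_n.
Context (T : Type) (M : masure_data R n T).

Definition apartment_structure (A : set T) (IsomA : set (V -> T)) : Prop :=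
  [/\ IsomA !=set0,
      forall f, IsomA f -> set_bij [set: V] A f &
      forall f0 f, IsomA f0 ->
        (IsomA f <-> exists2 w, affine_weyl D w & f = f0 \o w)].

Definition apt_chart (A : set T) (f : V -> T) : Prop := apt M A /\ isom M A f.

Definition apt_isom (A A' : set T) (phi : T -> T) : Prop :=
  set_bij A A' phi /\
  forall f, set_bij [set: V] A f -> (isom M A f <-> isom M A' (phi \o f)).

(* [phi], only meaningful on A, fixes the filter F of A. *)
Definition fixes (A : set T) (phi : T -> T) (F : set_system T) : Prop :=
  F [set x | A x /\ phi x = x].

Definition ma2_filter (F : set_system V) : Prop :=
  [\/ exists x, F = globally [set x],
      exists x y, (vle D x y \/ vle D y x) /\ F = germ x (segment x y),
      exists x y, [/\ x <> y, tits_int D (y - x) & F = globally (ray x y)] |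
      exists x F0 Fv,
        [/\ vface D F0, vface D Fv, solid D x F0 Fv & F = chimney D x F0 Fv]].

Definition ma2_hyp (A A' : set T) (f : V -> T) (F : set_system V) : Prop :=
  [/\ apt_chart A f, apt M A', ma2_filter F & fmap f F A'].

Definition splayed_germ (RR : set_system T) : Prop :=
  exists A f x F0 Fv,
    [/\ apt_chart A f, vface D F0, vface D Fv, spherical_vface D Fv
      & RR = fmap f (chimney_germ D x F0 Fv)].

Definition face_or_solid_germ (F : set_system T) : Prop :=
  exists A f, apt_chart A f /\
    ((exists2 F1, face D F1 & F = fmap f F1) \/
     (exists x F0 Fv,
        [/\ vface D F0, vface D Fv, solid D x F0 Fv
          & F = fmap f (chimney_germ D x F0 Fv)])).

(* The filter of V corresponding through f to a filter contained in f(V). *)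
Definition pull (f : V -> T) (F : set_system T) : set_system V :=
  [set S | F (f @` S)].

(* The union of two filters is the set of their common elements. *)
Definition cl_union (f : V -> T) (RR F : set_system T) : set_system T :=
  fmap f (cl D (pull f RR `&` pull f F)).

Definition ma4_hyp (A A' : set T) (f : V -> T) (RR F : set_system T) : Prop :=
  [/\ apt_chart A f, apt M A', splayed_germ RR, face_or_solid_germ F
    & [/\ RR A, F A, RR A' & F A']].

Record is_masure : Prop := IsMasure {
  masure_cover : forall x : T, exists2 A, apt M A & A x;
  masure_MA1 : forall A, apt M A -> apartment_structure A (isom M A);
  masure_MA2 : forall A A' f F, ma2_hyp A A' f F ->
    fmap f (cl D F) (A `&` A') /\
    exists2 phi, apt_isom A A' phi & fixes A phi (fmap f (cl D F));
  masure_MA3 : forall RR F, splayed_germ RR -> face_or_solid_germ F ->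
    exists2 A, apt M A & RR A /\ F A;
  masure_MA4 : forall A A' f RR F, ma4_hyp A A' f RR F ->
    exists2 phi, apt_isom A A' phi & fixes A phi (cl_union f RR F);
  masure_MAO : forall A A' f f' u v u' v',
    apt_chart A f -> apt_chart A' f' -> f u = f' u' -> f v = f' v' ->
    vle D u v -> f @` segment u v = f' @` segment u' v'
}.

Definition chambers_containing (P : set_system T) : set (set_system T) :=
  [set C | exists A f P0 C0,
     [/\ apt_chart A f, face D P0 /\ chamber D C0, face_le P0 C0,
         P = fmap f P0 & C = fmap f C0]].

Definition thick_finite_thickness : Prop :=
  forall A f P0, apt_chart A f -> panel D P0 ->
    finite_set (chambers_containing (fmap f P0)) /\
    (`I_3 #<= chambers_containing (fmap f P0))%card.

(* As the stabilizer of an apartment induces W^v |x Y on it, and not only W^a,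
   an automorphism transports the structure of apartments up to W^v |x Y. *)
Definition automorphism (g : T -> T) : Prop :=
  [/\ bijective g,
      forall A, apt M A <-> apt M (g @` A) &
      forall A f, apt_chart A f ->
        exists f' u, [/\ isom M (g @` A) f', weyl_Y D u & g \o f = f' \o u]].

Definition perm_group (G : set (T -> T)) : Prop :=
  [/\ G id, forall g h, G g -> G h -> G (g \o h) &
      forall g, G g -> exists h, [/\ G h, cancel g h & cancel h g]].

Definition induced_by (G : set (T -> T)) (A : set T) (phi : T -> T) : Prop :=
  exists2 g, G g & forall x, A x -> g x = phi x.

Record strongly_transitive (G : set (T -> T)) : Prop := StronglyTransitive {
  st_group : perm_group G;
  st_automorphism : G `<=` automorphism;
  st_MA2 : forall A A' f F phi, ma2_hyp A A' f F -> apt_isom A A' phi ->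
    fixes A phi (fmap f (cl D F)) -> induced_by G A phi;
  st_MA4 : forall A A' f RR F phi, ma4_hyp A A' f RR F -> apt_isom A A' phi ->
    fixes A phi (cl_union f RR F) -> induced_by G A phi
}.

(* [iota] is the identification of V with the fundamental apartment. *)
Record fundamental_apartment (G : set (T -> T)) (iota : V -> T) : Prop :=
  FundamentalApartment {
  fund_chart : apt_chart (range iota) iota;
  fund_apt : forall A, apt M A <-> exists2 g, G g & A = g @` range iota;
  fund_stab : forall u : V -> V,
    weyl_Y D u <->
    exists g, [/\ G g, g @` range iota = range iota & g \o iota = iota \o u]
}.

Section Retractions.
Context (G : set (T -> T)) (iota : V -> T).

Definition retraction (e : set_system V) (x : T) : V :=
  xget 0 [set z | exists B phi,
    [/\ apt M B, B x, fmap iota e B, apt_isom B (range iota) phi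
      & fixes B phi (fmap iota e) /\ phi x = iota z]].

Definition rho_pinfty : T -> V := retraction (@pinfty R I n D).
Definition rho_minfty : T -> V := retraction (@minfty R I n D).

Definition mle (x y : T) : Prop :=
  exists A f u v, [/\ apt_chart A f, f u = x, f v = y & vle D u v].

Definition dv (x y : T) : V :=
  xget 0 [set l | exists g u v,
    [/\ G g, g x = iota u, g y = iota v & l = pp D (v - u)]].

Definition Sv (x : T) (lam : V) : set T := [set y | mle x y /\ dv x y = lam].

End Retractions.
End Masure.

(* Main.v *)
(* Choose an apartment through x and +oo; in it x + R_+ nu is a ray, for nu in
   the open fundamental chamber, which eventually enters A. Its image under
   rho_-oo is locally a path of speed in W^v.nu, because the germs of apartments
   towards -oo and along the ray lie in a common apartment. Since nu - w nu is a
   nonnegative combination of simple coroots, comparing the two ends of the ray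
   gives -mu in Q^vee_R+, which is (1). Moreover every partial defect of the path
   is at most -mu, so when lambda is sufficiently dominant the whole path is
   dominant. Going back along the ray from A, the sector towards -oo based at the
   current point then always contains 0; at x this gives an apartment containing
   0 and x in which x - 0 = lambda, which is (2). *)
Require Import Defs.
From mathcomp Require Import all_boot all_order all_algebra.
From mathcomp Require Import all_classical all_reals all_analysis.
From mathcomp Require Import ring lra zify.
Import Order.TTheory GRing.Theory Num.Theory.
Import numFieldNormedType.Exports.
Local Open Scope classical_set_scope.
Local Open Scope ring_scope.

Set Implicit Arguments.
Unset Strict Implicit.
Unset Printing Implicit Defensive.

(** The axioms do not place two given points in a common apartment, only a germ at infinity with a
    face or with another germ; hence the detour through charts that agree with [iota] near an
    infinity. Two such charts which meet at a point agree on the whole closed sector issued from it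
    ([echart_agree]). This one fact computes the retractions and, applied step by step along the
    ray, carries the origin from one apartment to the next. Membership in [Sv] meets a further
    obstacle: [dv] is chosen among all elements of [G] that bring both points into the fundamental
    apartment, so its value must be shown independent of that element. MAO compares segments only as
    sets, which leaves a scaling factor open; the retraction inequality behind (1), used for an
    element of [G] and for its inverse, forces this factor to be 1. *)

(** * Free integral families over fields of characteristic zero *)

Section IntegralFreeness.
Context (I : finType) (n : nat) (a : I -> 'rV[int]_n).
Context (afree : Zfree a).

Definition family_mx (K : pzRingType) : 'M[K]_(#|I|, n) :=
  \matrix_(i, k) (a (enum_val i) 0 k)%:~R.

Lemma mul_family_mx (K : comPzRingType) (c : I -> K) :
  (\row_i c (enum_val i)) *m family_mx K = \sum_i c i *: ofY K (a i).
Proof.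
apply/rowP => k; rewrite !mxE summxE.
rewrite (reindex (@enum_val I I)) /=; last exact: (onW_bij _ (enum_val_bij I)).
by apply: eq_bigr => i _; rewrite !mxE.
Qed.

(** Clearing denominators: a rational relation multiplied by the product [d] of its denominators is
    an integral one, to which [Zfree] applies. *)
Lemma family_mx_free_rat : row_free (family_mx rat).
Proof.
rewrite -kermx_eq0; apply/eqP/row_matrixP => r.
rewrite row0; set v := row r _.
have hv : v *m family_mx rat = 0 by rewrite -row_mul mulmx_ker row0.
pose d : int := \prod_j denq (v 0 j).
have d0 : d != 0 by apply/prodf_neq0 => j _; apply: denq_neq0.
have vq j : exists z : int, v 0 j * d%:~R = z%:~R.
  exists (numq (v 0 j) * \prod_(j' | j' != j) denq (v 0 j')).
  rewrite /d (bigD1 j) //= !intrM mulrA; congr (_ * _).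
  by rewrite -[X in X * _]divq_num_den divfK // intr_eq0 denq_neq0.
have [z hz] := choice vq.
have hz0 : \sum_i z (enum_rank i) *: a i = 0.
  apply/rowP => k; rewrite summxE mxE.
  apply: (@intr_inj rat); rewrite rmorph_sum /= rmorph0.
  have := congr1 (fun m : 'rV_n => d%:~R * m 0 k) hv.
  rewrite !mxE mulr0 mulr_sumr; apply: etrans.
  rewrite (reindex (@enum_rank I)) /=; last exact: (onW_bij _ (enum_rank_bij I)).
  apply: eq_bigr => i _; rewrite [in LHS]mxE rmorphM /= -hz !mxE enum_rankK.
  by rewrite [RHS]mulrA [d%:~R * _]mulrC.
apply/rowP => j; rewrite [RHS]mxE.
have := afree hz0 (enum_val j); rewrite enum_valK => zj.
have := hz j; rewrite zj => /eqP; rewrite mulf_eq0 => /orP[/eqP//|].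
by rewrite intr_eq0 (negPf d0).
Qed.

Lemma family_mx_free (K : numFieldType) : row_free (family_mx K).
Proof.
have -> : family_mx K = map_mx ratr (family_mx rat).
  by apply/matrixP => i k; rewrite !mxE ratr_int.
by rewrite row_free_map; exact: family_mx_free_rat.
Qed.

Lemma free_real (K : numFieldType) (c : I -> K) :
  \sum_i c i *: ofY K (a i) = 0 -> forall i, c i = 0.
Proof.
rewrite -mul_family_mx => h i.
have : (\row_i c (enum_val i)) = 0 :> 'rV_#|I|.
  by apply: (row_free_inj (family_mx_free K)); rewrite h mul0mx.
by move/rowP/(_ (enum_rank i)); rewrite !mxE enum_rankK.
Qed.

(** The columns of a right inverse of the matrix of the family are added up. For the simple roots,
    this makes the open fundamental chamber nonempty. *)
Lemma dual_point (K : numFieldType) :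
  exists v : 'rV[K]_n, forall i, pairing (a i) v = 1.
Proof.
have /row_freeP [B hB] := family_mx_free K.
exists (\row_k (\sum_j B k j)) => i.
have : \sum_j (family_mx K *m B) (enum_rank i) j = 1.
  rewrite hB (bigD1 (enum_rank i)) //= big1 ?addr0 ?mxE ?eqxx // => j.
  by rewrite eq_sym mxE => /negPf ->.
under eq_bigr do rewrite mxE; rewrite exchange_big /= => <-.
by apply: eq_bigr => k _; rewrite !mxE mulr_sumr; apply: eq_bigr => j _; rewrite ?mxE ?enum_rankK.
Qed.

End IntegralFreeness.

(** * Weyl group words and positivity of coroots *)

Section WeylGroup.
Context (R : realType) (I : finType) (n : nat) (D : root_generating_system I n).
Local Notation V := 'rV[R]_n.
Local Notation alpha := (@alpha R I n D).
Local Notation coroot := (coroot R D).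
Local Notation refl := (@refl R I n D).
Local Notation word := (@weyl_word R I n D).
Local Notation Qpos := (@Qvee_pos R I n D).
Implicit Types (u v : V) (s t : seq I).

Lemma alphaD i u v : alpha i (u + v) = alpha i u + alpha i v.
Proof.
by rewrite /Defs.alpha /pairing -big_split; apply: eq_bigr => k _; rewrite mxE mulrDr.
Qed.

Lemma alphaZ i (c : R) v : alpha i (c *: v) = c * alpha i v.
Proof.
rewrite /Defs.alpha /pairing mulr_sumr; apply: eq_bigr => k _.
by rewrite mxE mulrCA.
Qed.

Lemma alphaN i v : alpha i (- v) = - alpha i v.
Proof. by rewrite -scaleN1r alphaZ mulN1r. Qed.

Lemma alphaB i u v : alpha i (u - v) = alpha i u - alpha i v.
Proof. by rewrite alphaD alphaN. Qed.

Lemma alpha0 i : alpha i 0 = 0.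
Proof. by rewrite -(scale0r 0) alphaZ mul0r. Qed.

Lemma alpha_sum i (J : finType) (F : J -> V) :
  alpha i (\sum_j F j) = \sum_j alpha i (F j).
Proof. exact: (big_morph _ (alphaD i) (alpha0 i)). Qed.

Lemma alpha_coroot i j : alpha i (coroot j) = (gcm D j i)%:~R.
Proof.
rewrite gcmE /Defs.alpha /pairing rmorph_sum /=; apply: eq_bigr => k _.
by rewrite rmorphM /= !mxE intz.
Qed.

Lemma alpha_coroot_diag i : alpha i (coroot i) = 2.
Proof. by rewrite alpha_coroot gcm_diag. Qed.

Lemma reflD i u v : refl i (u + v) = refl i u + refl i v.
Proof. by rewrite /Defs.refl alphaD scalerDl opprD addrACA. Qed.

Lemma reflZ i (c : R) v : refl i (c *: v) = c *: refl i v.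
Proof. by rewrite /Defs.refl alphaZ scalerBr scalerA. Qed.

Lemma reflK i : involutive (refl i).
Proof.
move=> v; rewrite /Defs.refl alphaB alphaZ alpha_coroot_diag.
have -> : alpha i v - alpha i v * 2 = - alpha i v by ring.
by rewrite scaleNr opprK subrK.
Qed.

Lemma wordD s u v : word s (u + v) = word s u + word s v.
Proof. by elim: s => //= i s ->; rewrite reflD. Qed.

Lemma wordZ s (c : R) v : word s (c *: v) = c *: word s v.
Proof. by elim: s => //= i s ->; rewrite reflZ. Qed.

Lemma word_cat s t v : word (s ++ t) v = word s (word t v).
Proof. by rewrite /weyl_word foldr_cat. Qed.

Lemma word_rcons s i v : word (rcons s i) v = word s (refl i v).
Proof. by rewrite -cats1 word_cat. Qed.

Lemma word_revK s v : word (rev s) (word s v) = v.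
Proof. by elim: s => //= i s IH; rewrite rev_cons word_rcons reflK. Qed.

Lemma weyl_id : weyl D (@id V).
Proof. by exists [::]. Qed.

Lemma weyl_refl i : weyl D (refl i).
Proof. by exists [:: i]. Qed.

Lemma weyl_comp (w w' : V -> V) : weyl D w -> weyl D w' -> weyl D (w \o w').
Proof.
by move=> [s _ <-] [t _ <-]; exists (s ++ t) => //; apply/funext => v; rewrite word_cat.
Qed.

Lemma weyl_inv (w : V -> V) : weyl D w ->
  exists w', [/\ weyl D w', cancel w w' & cancel w' w].
Proof.
move=> [s _ <-]; exists (word (rev s)); split; first by exists (rev s).
  exact: word_revK.
by move=> v; rewrite -[s in word s _]revK word_revK.
Qed.

Lemma weylD (w : V -> V) u v : weyl D w -> w (u + v) = w u + w v.
Proof. by move=> [s _ <-]; exact: wordD. Qed.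

Lemma weylZ (w : V -> V) (c : R) v : weyl D w -> w (c *: v) = c *: w v.
Proof. by move=> [s _ <-]; exact: wordZ. Qed.

Lemma weylN (w : V -> V) v : weyl D w -> w (- v) = - w v.
Proof. by move=> hw; rewrite -scaleN1r weylZ // scaleN1r. Qed.

Lemma weylB (w : V -> V) u v : weyl D w -> w (u - v) = w u - w v.
Proof. by move=> hw; rewrite weylD // weylN. Qed.

Lemma weyl0 (w : V -> V) : weyl D w -> w 0 = 0.
Proof. by move=> hw; rewrite -(scale0r 0) weylZ // !scale0r. Qed.

Lemma QposD u v : Qpos u -> Qpos v -> Qpos (u + v).
Proof.
move=> [c [hc ->]] [d [hd ->]]; exists (fun i => c i + d i); split.
  by move=> i; rewrite addr_ge0.
by rewrite -big_split; apply: eq_bigr => i _; rewrite scalerDl.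
Qed.

Lemma QposZ (a : R) v : 0 <= a -> Qpos v -> Qpos (a *: v).
Proof.
move=> a0 [c [hc ->]]; exists (fun i => a * c i); split.
  by move=> i; rewrite mulr_ge0.
by rewrite scaler_sumr; apply: eq_bigr => i _; rewrite scalerA.
Qed.

Lemma Qpos0 : Qpos 0.
Proof. by exists (fun=> 0); split=> //; rewrite big1 // => i _; rewrite scale0r. Qed.

Lemma Qpos_coroot i : Qpos (coroot i).
Proof.
exists (fun j => (j == i)%:R); split; first by move=> j; rewrite ler0n.
rewrite (bigD1 i) //= eqxx scale1r big1 ?addr0 // => j /negPf ->.
by rewrite scale0r.
Qed.

Lemma coroot_free (c : I -> R) : \sum_i c i *: coroot i = 0 -> forall i, c i = 0.
Proof. exact: (free_real (@scoroot_free _ _ D)). Qed.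

Lemma coroot_inj (c d : I -> R) :
  \sum_i c i *: coroot i = \sum_i d i *: coroot i -> c =1 d.
Proof.
move=> /eqP; rewrite -subr_eq0 -sumrB => /eqP h i; apply/eqP.
rewrite -subr_eq0; apply/eqP; move: i; apply: coroot_free.
by rewrite -[RHS]h; apply: eq_bigr => i _; rewrite scalerBl.
Qed.

Lemma Qpos_pointed v : Qpos v -> Qpos (- v) -> v = 0.
Proof.
move=> [c [hc ->]] [d [hd hcd]]; rewrite big1 // => i _.
suff -> : c i = 0 by rewrite scale0r.
have : \sum_i (c i + d i) *: coroot i = 0.
  by under eq_bigr do rewrite scalerDl; rewrite big_split /= -hcd subrr.
move/coroot_free/(_ i)/eqP; rewrite paddr_eq0 //.
by move=> /andP[/eqP].
Qed.

Lemma regular_point : exists v : V, forall i, alpha i v = 1.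
Proof. exact: (dual_point (@sroot_free _ _ D)). Qed.

Lemma refl_coroot_pair i j (a b : R) :
  refl i (a *: coroot i + b *: coroot j) =
  (- a - (gcm D j i)%:~R * b) *: coroot i + b *: coroot j.
Proof.
rewrite /Defs.refl alphaD !alphaZ alpha_coroot_diag alpha_coroot addrAC -scalerBl.
by congr (_ *: _ + _); ring.
Qed.

(* Rescaling makes every rank two matrix symmetric, whence the invariant
   quadratic form A a^2 + A c_ji a b + B b^2 on the plane of the coroots. *)
Lemma rank2_symmetrizer i j : i != j ->
  exists A B : int, [/\ 0 < A, 0 < B & A * gcm D j i = B * gcm D i j].
Proof.
move=> ij; have ji : j != i by rewrite eq_sym.
case: (eqVneq (gcm D j i) 0) => [p0|p0].
  have q0 : gcm D i j = 0 by apply/gcm_eq0.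
  by exists 1, 1; rewrite p0 q0.
have q0 : gcm D i j != 0 by apply: contra p0 => /eqP q0; apply/eqP/gcm_eq0.
exists (- gcm D i j), (- gcm D j i).
rewrite !oppr_gt0 !lt_neqAle p0 q0 !gcm_offdiag //.
by split=> //; rewrite !mulNr mulrC.
Qed.

Lemma dual_pair_refl i j (A B a b : R) v :
  A * (gcm D j i)%:~R = B * (gcm D i j)%:~R ->
  A * (- a - (gcm D j i)%:~R * b) * alpha i (refl i v) + B * b * alpha j (refl i v) =
  A * a * alpha i v + B * b * alpha j v.
Proof.
move=> hAB; rewrite /Defs.refl !alphaB !alphaZ !alpha_coroot gcm_diag.
apply/eqP; rewrite -subr_eq0; apply/eqP.
transitivity (b * alpha i v * (A * (gcm D j i)%:~R - B * (gcm D i j)%:~R)).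
  by ring.
by rewrite hAB subrr mulr0.
Qed.

(** * Dihedral subgroups acting on the plane of two coroots *)

Section RankTwo.
Context (i j : I) (A B : int) (hAB : A * gcm D j i = B * gcm D i j).

(* The last clause says that u r_i u^-1 is the reflection whose coroot is
   u alpha_i^vee: A a alpha_i + B b alpha_j is A times the dual root. *)
Definition rank2_coords s (a b : int) := [/\
  word s (coroot i) = a%:~R *: coroot i + b%:~R *: coroot j,
  A * a ^+ 2 + A * gcm D j i * a * b + B * b ^+ 2 = A &
  forall v, A%:~R *: word s (refl i v) = A%:~R *: word s v -
    (A%:~R * a%:~R * alpha i (word s v) + B%:~R * b%:~R * alpha j (word s v))
      *: (a%:~R *: coroot i + b%:~R *: coroot j)].

Lemma rank2_coords_nil : rank2_coords [::] 1 0.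
Proof.
split; rewrite /= ?scale1r ?scale0r ?addr0 //; first by ring.
by move=> v; rewrite mulr1 mulr0 mul0r addr0 /Defs.refl scalerBr scalerA.
Qed.

Lemma rank2_coords_consl s a b :
  rank2_coords s a b -> rank2_coords (i :: s) (- a - gcm D j i * b) b.
Proof.
have hR : (A%:~R : R) * (gcm D j i)%:~R = B%:~R * (gcm D i j)%:~R.
  by rewrite -!intrM hAB.
move=> [h1 h2 h3]; split.
- by rewrite /= h1 refl_coroot_pair intrB intrN intrM.
- by rewrite -[RHS]h2; ring.
- move=> v /=; rewrite -!reflZ h3 -scaleNr reflD [refl i (- _ *: _)]reflZ scaleNr.
  by rewrite refl_coroot_pair intrB intrN intrM (dual_pair_refl _ _ _ hR).
Qed.

Lemma rank2_coords_consr s a b :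
  rank2_coords s a b -> rank2_coords (j :: s) a (- b - gcm D i j * a).
Proof.
have hR : (B%:~R : R) * (gcm D i j)%:~R = A%:~R * (gcm D j i)%:~R.
  by rewrite -!intrM hAB.
move=> [h1 h2 h3]; split.
- by rewrite /= h1 addrC refl_coroot_pair intrB intrN intrM addrC.
- rewrite -[RHS]h2 hAB; apply/eqP; rewrite -subr_eq0; apply/eqP.
  by ring.
- move=> v /=; rewrite -!reflZ h3 -scaleNr reflD [refl j (- _ *: _)]reflZ scaleNr.
  rewrite [_ *: coroot i + _]addrC refl_coroot_pair intrB intrN intrM.
  have := dual_pair_refl b%:~R a%:~R (word s v) hR.
  by rewrite addrC [RHS]addrC => <-; rewrite [_ *: coroot j + _]addrC.
Qed.

End RankTwo.

(** Letters are added on the left as long as both coordinates stay nonnegative. When the letter [x]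
    makes one negative, the norm excludes mixed signs, so the previous coroot was a multiple of that
    of [x]; then [word s] conjugates [r_i] to [r_x], and the two occurrences of [r_x] cancel. *)
Lemma rank2_exchange i j s : i != j -> {subset s <= [:: i; j]} ->
  (exists a b : R, [/\ 0 <= a, 0 <= b &
      word s (coroot i) = a *: coroot i + b *: coroot j]) \/
  (exists2 s', (size s' < size s)%N & forall v, word s' v = word s (refl i v)).
Proof.
move=> ij hs; have [A [B [A0 B0 hAB]]] := rank2_symmetrizer ij.
have p0 := gcm_offdiag D (introN eqP (nesym (elimN eqP ij))).
have q0 := gcm_offdiag D ij.
have AR0 : (A%:~R : R) != 0 by rewrite intr_eq0 gt_eqF.
suff :
  (exists a b : int, [/\ 0 <= a, 0 <= b & rank2_coords i j A B s a b]) \/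
  (exists2 s', (size s' < size s)%N & forall v, word s' v = word s (refl i v)).
  case=> [[a [b [a0 b0 [h _ _]]]]|]; last by right.
  by left; exists a%:~R, b%:~R; rewrite !ler0z.
(* A mixed root a < 0 < b would have norm at least A + B. *)
have mixed (a b : int) : a * b < 0 ->
  A * a ^+ 2 + A * gcm D j i * a * b + B * b ^+ 2 <> A.
  move=> ab h.
  have a2 : 1 <= a ^+ 2 by rewrite -gtz0_ge1 exprn_even_gt0 //; nia.
  have b2 : 1 <= b ^+ 2 by rewrite -gtz0_ge1 exprn_even_gt0 //; nia.
  have : 0 <= A * gcm D j i * a * b.
    rewrite -mulrA mulr_le0 ?ltW //; nia.
  nia.
elim: s hs => [_|x s IH hs].
  left; exists 1, 0; split=> //; exact: rank2_coords_nil.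
have [|[a [b [a0 b0 hab]]]|[s' ss' hs']] := IH; last first.
- by right; exists (x :: s') => //= v; rewrite hs'.
- have : x \in [:: i; j] by apply: hs; rewrite inE eqxx.
  rewrite !inE => /orP[] /eqP xE; subst x.
    have hab' := rank2_coords_consl hAB hab.
    have [c0|c0] := leP 0 (- a - gcm D j i * b); first by left; exists (- a - gcm D j i * b), b.
    right; exists s => // v.
    have b00 : b = 0.
      have [//|bn0] := eqVneq b 0; exfalso; apply: (mixed (- a - gcm D j i * b) b).
        by rewrite nmulr_rlt0 // lt_neqAle eq_sym bn0.
      by have [] := hab'.
    rewrite b00 in hab hab' c0.
    have [_ ha2 _] := hab; have [_ _ h3] := hab.
    have a1 : a = 1 by nia.
    have := h3 v; rewrite a1 scale1r scale0r addr0 mulr1 mulr0 mul0r addr0.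
    rewrite -scalerA -scalerBr => /(scalerI AR0) /= ->.
    by rewrite -/(refl i _) reflK.
  have hab' := rank2_coords_consr hAB hab.
  have [c0|c0] := leP 0 (- b - gcm D i j * a); first by left; exists a, (- b - gcm D i j * a).
  right; exists s => // v.
  have a00 : a = 0.
    have [//|an0] := eqVneq a 0; exfalso; apply: (mixed a (- b - gcm D i j * a)).
      by rewrite nmulr_llt0 // lt_neqAle eq_sym an0.
    by have [] := hab'.
  rewrite a00 in hab hab' c0.
  have [_ hb2 h3] := hab.
  have := h3 v; rewrite scale0r add0r mulr0 mul0r add0r scalerA.
  (* With [a = 0] the invariant norm reads [B b^2 = A]. *)
  have -> : B%:~R * b%:~R * alpha j (word s v) * b%:~R = A%:~R * alpha j (word s v).
    by rewrite -[in RHS]hb2 intrD; ring.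
  rewrite -scalerA -scalerBr => /(scalerI AR0) /= ->.
  by rewrite -/(refl j _) reflK.
- by move=> y ys; apply: hs; rewrite inE ys orbT.
Qed.

Definition reduced s :=
  forall s', (forall v, word s' v = word s v) -> (size s <= size s')%N.

Lemma reducedP (w : V -> V) : weyl D w -> exists2 s, reduced s & forall v, w v = word s v.
Proof.
move=> [s0 _ <-].
have ex : exists k, `[< exists2 s, size s = k & forall v, word s0 v = word s v >].
  by exists (size s0); apply/asboolP; exists s0.
case: (ex_minnP ex) => k /asboolP [s sk hs] kmin; exists s => // s' hs'.
by rewrite sk; apply: kmin; apply/asboolP; exists s' => // v; rewrite hs hs'.
Qed.

(* Split a reduced word s, not shortened by r_i, as v u with u in the dihedral
   group of i and the last letter of s, and v as short as possible; then neither
   generator shortens v, so v keeps positive the coroots of both. *)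
Lemma word_coroot_pos s i : reduced s ->
  (forall s', (forall v, word s' v = word s (refl i v)) -> (size s <= size s')%N) ->
  Qpos (word s (coroot i)).
Proof.
have [m] := ubnP (size s); elim: m s i => // m IH s i ssize sred si.
case/lastP: s ssize sred si => [|s0 j] ssize sred si; first exact: Qpos_coroot.
set s := rcons s0 j in ssize sred si *.
have ij : i != j.
  apply/eqP => ij; have := si s0; rewrite /s ij size_rcons ltnn => H.
  by apply: (elimF idP erefl) (H _) => v; rewrite word_rcons reflK.
pose splits k := exists v u : seq I, [/\ size v = k, {subset u <= [:: i; j]},
  forall x, word s x = word v (word u x) & size s = (size v + size u)%N].
have split0 : `[< splits (size s0) >].
  apply/asboolP; exists s0, [:: j]; split=> //.
  - by move=> y; rewrite !inE => ->; rewrite orbT.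
  - by move=> x; rewrite /s word_rcons.
  - by rewrite size_rcons addn1.
have ex : exists k, `[< splits k >] by exists (size s0).
case: (ex_minnP ex) => k /asboolP [v [u [vk hu hvu svu]]] kmin.
have ks0 := kmin _ split0.
have vred : reduced v.
  move=> v' hv'; rewrite -(leq_add2r (size u)) -svu -size_cat; apply: sred => x.
  by rewrite word_cat hv' hvu.
have vpos x : x \in [:: i; j] -> Qpos (word v (coroot x)).
  move=> xij; apply: IH => //.
    by rewrite vk (leq_ltn_trans ks0) // -ltnS -[(size s0).+1](size_rcons s0 j).
  move=> v' hv'; rewrite leqNgt; apply/negP => v'v.
  have hs' y : word s y = word v' (word (x :: u) y) by rewrite hvu /= hv' reflK.
  suff /kmin : `[< splits (size v') >] by rewrite -vk leqNgt v'v.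
  apply/asboolP; exists v', (x :: u); split=> //.
    by move=> y; rewrite inE => /orP[/eqP -> //|/hu].
  have := sred (v' ++ x :: u); rewrite size_cat /= => H.
  have : (size s <= size v' + (size u).+1)%N by apply: H => y; rewrite word_cat -hs'.
  by rewrite svu; lia.
have [[a [b [a0 b0 hab]]]|[u' uu' hu']] := rank2_exchange ij hu.
  rewrite hvu hab wordD !wordZ; apply: QposD; apply: QposZ => //; apply: vpos;
    by rewrite !inE eqxx ?orbT.
have := si (v ++ u'); rewrite size_cat svu leq_add2l leqNgt uu' => H.
by suff : false by []; apply: H => x; rewrite word_cat hu' hvu.
Qed.

(** Removing the last letter [i] of a reduced word changes the difference by [alpha i v] times the
    image of the coroot of [i], which is positive because the longer word is reduced too. *)
Lemma dominant_sub_weyl (w : V -> V) v : weyl D w ->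
  (forall i, 0 <= alpha i v) -> Qpos (v - w v).
Proof.
move=> /reducedP [s sred hs] hv; rewrite hs {w hs}.
elim/last_ind: s sred => [|s i IH] sred; first by rewrite /= subrr; exact: Qpos0.
have sred' : reduced s.
  move=> s' hs'; have := sred (rcons s' i); rewrite !size_rcons ltnS; apply.
  by move=> x; rewrite !word_rcons.
rewrite word_rcons /Defs.refl wordD -scaleNr wordZ opprD addrA -scaleNr opprK.
apply: QposD; first exact: IH.
apply: QposZ => //; apply: word_coroot_pos => // s' hs'.
apply: leq_trans (_ : size (rcons s i) <= _)%N; first by rewrite size_rcons.
by apply: sred => x; rewrite word_rcons.
Qed.

Lemma dominant_orbit_unique (w : V -> V) v : weyl D w ->
  (forall i, 0 <= alpha i v) -> (forall i, 0 <= alpha i (w v)) -> w v = v.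
Proof.
move=> hw hv hwv; apply/esym/eqP; rewrite -subr_eq0; apply/eqP.
apply: Qpos_pointed; first exact: dominant_sub_weyl.
have [w' [hw' ww' _]] := weyl_inv hw.
by rewrite opprB -[X in _ - X]ww'; exact: dominant_sub_weyl.
Qed.

End WeylGroup.

(** * Cones, faces, sector-germs and enclosures *)

Section Cones.
Context (R : realType) (I : finType) (n : nat) (D : root_generating_system I n).
Local Notation V := 'rV[R]_n.
Local Notation alpha := (@alpha R I n D).
Implicit Types (u v d x z : V) (S : set V) (b : bool).

(* The open fundamental chamber and its opposite, treated uniformly. *)
Definition cone b : set V := [set v | forall i, 0 < (-1) ^+ b * alpha i v].
Definition ccone b : set V := [set v | forall i, 0 <= (-1) ^+ b * alpha i v].

Lemma cone_false : cone false = Cvf D.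
Proof. by apply/seteqP; split=> v hv i; have := hv i; rewrite mul1r. Qed.

Lemma cone_true : cone true = opps (Cvf D).
Proof.
apply/seteqP; split=> [v hv|_ [v hv <-] i]; last by rewrite expr1 alphaN mulN1r opprK.
exists (- v); last exact: opprK.
by move=> i; have := hv i; rewrite expr1 alphaN mulN1r.
Qed.

Lemma coneZ b (t : R) d : 0 < t -> cone b d -> cone b (t *: d).
Proof. by move=> t0 hd i; rewrite alphaZ mulrCA mulr_gt0. Qed.

Lemma coneD b u v : cone b u -> cone b v -> cone b (u + v).
Proof. by move=> hu hv i; rewrite alphaD mulrDr addr_gt0. Qed.

Lemma coneDc b u v : cone b u -> ccone b v -> cone b (u + v).
Proof. by move=> hu hv i; rewrite alphaD mulrDr ltr_wpDr. Qed.

Lemma cone_sign b d : cone false d -> cone b ((-1) ^+ b *: d).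
Proof.
move=> hd i; rewrite alphaZ mulrA -expr2 sqrr_sign mul1r.
by have := hd i; rewrite mul1r.
Qed.

Lemma unit_dir_subproof b : {v : V | forall i, (-1) ^+ b * alpha i v = 1}.
Proof.
have [v hv] := cid (regular_point R D).
by exists ((-1) ^+ b *: v) => i; rewrite alphaZ hv mulr1 -expr2 sqrr_sign.
Qed.

Definition unit_dir b : V := projT1 (unit_dir_subproof b).

Lemma alpha_unit_dir b i : (-1) ^+ b * alpha i (unit_dir b) = 1.
Proof. exact: (projT2 (unit_dir_subproof b)). Qed.

Lemma cone_unit_dir b : cone b (unit_dir b).
Proof. by move=> i; rewrite alpha_unit_dir. Qed.

Lemma cone_absorb b d : exists2 t : R, 0 < t & cone b (t *: unit_dir b + d).
Proof.
have s0 : 0 <= \sum_i `|alpha i d| by apply: sumr_ge0.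
exists (1 + \sum_i `|alpha i d|); first by rewrite ltr_pwDl.
move=> i; rewrite alphaD alphaZ mulrDr mulrCA alpha_unit_dir mulr1.
have : `|alpha i d| <= \sum_i `|alpha i d|.
  by rewrite (bigD1 i) //= lerDl sumr_ge0.
have := ler_norm (- ((-1) ^+ b * alpha i d)); rewrite normrN normrM normr_sign mul1r.
by lra.
Qed.

Lemma alpha_continuous i : continuous (alpha i).
Proof.
apply: continuous_big => [|k _]; first exact: add_continuous.
by move=> v; apply: cvgMl_tmp; [exact: nbhs_filter|exact: coord_continuous].
Qed.

Lemma nbhs_line z S d : nbhs z S ->
  exists2 t0 : R, 0 < t0 & forall t, 0 <= t <= t0 -> S (z + t *: d).
Proof.
move=> hS.
have cont : (fun t : R => z + t *: d) @ 0 --> z.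
  rewrite -[X in _ --> X]addr0 -[in X in _ --> X](scale0r d).
  by apply: cvgD; [exact: cvg_cst|apply: cvgZr_tmp; exact: cvg_id].
have /nbhs_ballP [e /= e0 he] := cont _ hS.
exists (e / 2); first by rewrite divr_gt0.
move=> t /andP[t0 te]; apply: he; rewrite /ball /= sub0r normrN ger0_norm //.
by apply: le_lt_trans te _; rewrite ltr_pdivrMr // ltr_pMr // ltr1n.
Qed.

(** The minimal vectorial face, on which every root vanishes. MA3 and MA4 speak of faces and not of
    points; the face of direction [V0] at [x] stands for the point [x]. *)
Local Notation V0 := (Fvf D finset.setT : set V).

Lemma V0P v : V0 v <-> forall i, alpha i v = 0.
Proof.
split=> [[h _] i|h]; first by apply: h; rewrite finset.in_setT.
by split=> [i _|i]; rewrite ?h ?finset.in_setT.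
Qed.

Lemma V0_0 : V0 0.
Proof. by apply/V0P => i; rewrite alpha0. Qed.

Lemma vface_V0 : vface D V0.
Proof.
exists id, finset.setT; split; first exact: weyl_id.
by left; rewrite image_id.
Qed.

Lemma vface_cone b : vface D (cone b).
Proof.
have E : Fvf D finset.set0 = Cvf D :> set V.
  apply/seteqP; split=> [v [_ h] i|v h].
    by apply: h; rewrite finset.in_set0.
  by split=> i; rewrite ?finset.in_set0 // => _; exact: h.
exists id, finset.set0; split; first exact: weyl_id.
by case: b; [right; rewrite cone_true|left; rewrite cone_false]; rewrite image_id E.
Qed.

Lemma closure_V0 v : closure V0 v -> forall i, alpha i v = 0.
Proof.
move=> hv i; apply/eqP/negP => /negP hi.
pose U : set V := [set u | alpha i u != 0].
have : nbhs v U.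
  have cont : alpha i @ v --> alpha i v by exact: alpha_continuous.
  have : nbhs (alpha i v) [set r | r != 0] by apply: open_nbhs_nbhs; split => //; exact: open_neq.
  exact: cont.
by move=> /hv [u [/V0P hu]]; rewrite /U /= hu eqxx.
Qed.

Lemma root_formE (c : {ffun I -> int}) v : root_form D c v = \sum_i (c i)%:~R * alpha i v.
Proof. by []. Qed.

Lemma root_formD c u v : root_form D c (u + v) = root_form D c u + root_form D c v.
Proof.
by rewrite !root_formE -big_split; apply: eq_bigr => i _; rewrite alphaD mulrDr.
Qed.

Lemma root_formZ c (t : R) v : root_form D c (t *: v) = t * root_form D c v.
Proof.
by rewrite !root_formE mulr_sumr; apply: eq_bigr => i _; rewrite alphaZ mulrCA.
Qed.

Lemma root_form_eq0 c v : (forall i, alpha i v = 0) -> root_form D c v = 0.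
Proof. by move=> h; rewrite root_formE big1 // => i _; rewrite h mulr0. Qed.

Definition simple b i : {ffun I -> int} := [ffun j => if j == i then (-1) ^+ b else 0].

Lemma root_form_simple b i v : root_form D (simple b i) v = (-1) ^+ b * alpha i v.
Proof.
rewrite root_formE (bigD1 i) //= ffunE eqxx big1 ?addr0 => [|j /negPf ji].
  by case: b; rewrite ?expr1 ?expr0 ?mulrN1z.
by rewrite ffunE ji mul0r.
Qed.

Lemma Delta_simple b i : Delta R D (simple b i).
Proof.
left; case: b; last first.
  exists id, i; split; first exact: weyl_id.
  by move=> v; rewrite root_form_simple mul1r.
exists (refl D i), i; split; first exact: weyl_refl.
move=> v; rewrite root_form_simple expr1 mulN1r /refl alphaB alphaZ alpha_coroot_diag.
by ring.
Qed.

(** Convertible with the set [E] bound inside [cl], so that elements of [cl] can be taken apart. *)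
Definition encl (k : {ffun I -> int} -> option int) : set V :=
  [set v | forall c, Delta R D c -> halfspace_ext D c (k c) v].

Lemma lface_ray b x d S : cone b d -> lface D x (cone b) S ->
  exists2 t0 : R, 0 < t0 & forall t, 0 < t <= t0 -> S (x + t *: d).
Proof.
move=> hd [HH [_ [Om [/open_nbhs_nbhs hOm hsub]] hS]].
have [t0 t00 ht0] := nbhs_line d hOm; exists t0 => // t /andP[tp tt0].
apply: hS; apply: hsub; split; first by apply: ht0; rewrite (ltW tp).
by exists (t *: d) => //; exact: coneZ.
Qed.

(** A point slightly inside the cone is an interior point of [S] along every line. This makes the
    support of a chamber the whole space. *)
Lemma lface_cone_absorbing b x S : lface D x (cone b) S ->
  exists a, forall d, exists2 s : R, 0 < s & S (a + s *: d).
Proof.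
move=> [HH [_ [Om [[oOm xOm] hsub]] hS]].
have [t0 t00 ht0] := nbhs_line (unit_dir b) (open_nbhs_nbhs (conj oOm xOm)).
exists (x + t0 *: unit_dir b) => d.
have aOm : Om (x + t0 *: unit_dir b) by apply: ht0; rewrite ltW //=.
have [s0 s00 hs0] := nbhs_line d (open_nbhs_nbhs (conj oOm aOm)).
have [r r0 hr] := cone_absorb b d.
(* [s0] keeps the point in the neighbourhood [Om]; [t0 / r] keeps it in the cone, by leaving a
   nonnegative multiple [t0 - s * r] of [unit_dir]. *)
exists (Num.min s0 (t0 / r)); first by rewrite lt_min s00 divr_gt0.
set s := Num.min _ _.
have s_gt0 : 0 < s by rewrite lt_min s00 divr_gt0.
apply: hS; apply: hsub; split; first by apply: hs0; rewrite (ltW s_gt0) ge_min lexx.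
exists (t0 *: unit_dir b + s *: d); last by rewrite addrA.
have -> : t0 *: unit_dir b + s *: d = s *: (r *: unit_dir b + d) + (t0 - s * r) *: unit_dir b.
  by rewrite scalerDr scalerBl !scalerA addrAC [s * r *: _ + _]addrC subrK.
apply: coneDc; first exact: coneZ.
move=> i; rewrite alphaZ mulrCA alpha_unit_dir mulr1 subr_ge0.
by rewrite -ler_pdivlMr // ge_min lexx orbT.
Qed.

Lemma lface_V0_mem x S : lface D x V0 S -> S x.
Proof.
move=> [HH [_ [Om [[_ xOm] hsub]] hS]]; apply: hS; apply: hsub; split=> //.
by exists 0; [exact: V0_0|rewrite addr0].
Qed.

Lemma encl_lface_V0 k x : encl k x -> lface D x V0 (encl k).
Proof.
move=> hx; exists [set H | exists c k', [/\ Delta R D c, k c = Some k' & H = halfspace D c k']].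
split.
- by move=> H [c [k' [hc _ ->]]]; exists c, k'; split=> //; left.
- exists [set: V]; split; first by split=> //; exact: openT.
  move=> _ [_ [v hv <-]] H [c [k' [hc kc ->]]].
  have := hx c hc; rewrite kc /= /halfspace /= root_formD.
  by rewrite (root_form_eq0 c (v := v)) ?addr0 //; exact/V0P.
- move=> v hv c hc; case kc: (k c) => [k'|//]; apply: (hv (halfspace D c k')).
  by exists c, k'.
Qed.

Lemma lfaceS x F0 S S' : S `<=` S' -> lface D x F0 S -> lface D x F0 S'.
Proof.
by move=> SS' [HH [h1 h2 h3]]; exists HH; split=> //; exact: subset_trans SS'.
Qed.

Definition sect b : set_system V := sector_germ (cone b).

Lemma sect_false : sect false = pinfty D.
Proof. by rewrite /sect cone_false. Qed.

Lemma sect_true : sect true = minfty D.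
Proof. by rewrite /sect cone_true. Qed.

Lemma sectS b S S' : S `<=` S' -> sect b S -> sect b S'.
Proof. by move=> SS' [x hx]; exists x; exact: subset_trans SS'. Qed.

Lemma sectI b S S' : sect b S -> sect b S' -> sect b (S `&` S').
Proof.
move=> [x hx] [y hy]; have [t t0 ht] := cone_absorb b (x - y).
exists (x + t *: unit_dir b) => _ [v hv <-]; split.
  apply: hx; exists (t *: unit_dir b + v); last by rewrite addrA.
  by apply: coneD => //; apply: coneZ => //; exact: cone_unit_dir.
apply: hy; exists (t *: unit_dir b + (x - y) + v); first exact: coneD.
by rewrite [_ + (x - y)]addrC addrA addrA addrCA subrr addr0.
Qed.

(* The enclosure only needs the simple roots, rounded up to integers. *)
Lemma sect_encl b S : sect b S -> exists k xi, [/\ cone b xi, encl k `<=` S, sect b (encl k),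
  lface D xi (cone b) (encl k) &
  forall v d, encl k v -> cone b d -> encl k (v + d)].
Proof.
move=> [x0 hx0].
pose m := Num.bound (\sum_i `|alpha i x0| + 1).
have mP i : (-1) ^+ b * alpha i x0 < m%:R.
  have h1 : 0 <= \sum_i `|alpha i x0| + 1 by apply: addr_ge0 => //; apply: sumr_ge0.
  have := archi_boundP h1; rewrite -/m.
  have : `|alpha i x0| <= \sum_i `|alpha i x0|.
    by rewrite [leRHS](bigD1 i) //= lerDl sumr_ge0.
  have := ler_norm ((-1) ^+ b * alpha i x0); rewrite normrM normr_sign mul1r.
  by lra.
pose k (c : {ffun I -> int}) := if [exists i, c == simple b i] then Some (- m%:Z) else None.
have m0 : 0 < m%:R :> R.
  have h1 : 0 <= \sum_i `|alpha i x0| + 1 by apply: addr_ge0 => //; apply: sumr_ge0.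
  exact: le_lt_trans h1 (archi_boundP h1).
pose xi := m%:R *: unit_dir b.
have enclP v : encl k v <-> forall i, m%:R <= (-1) ^+ b * alpha i v.
  split=> [hv i|hv c hc].
    have := hv _ (Delta_simple b i); rewrite /k ifT; last by apply/existsP; exists i.
    by rewrite /= /halfspace /= root_form_simple mulrNz subr_ge0.
  rewrite /k; case: ifPn => // /existsP [i /eqP ->].
  by rewrite /= /halfspace /= root_form_simple mulrNz subr_ge0.
have enclD v d : encl k v -> cone b d -> encl k (v + d).
  move=> /enclP hv hd; apply/enclP => i; rewrite alphaD mulrDr.
  by rewrite ler_wpDr // ltW.
have hxi : encl k xi.
  by apply/enclP => i; rewrite alphaZ mulrCA alpha_unit_dir mulr1.
exists k, xi; split=> //.
- by apply: coneZ => //; exact: cone_unit_dir.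
- move=> v /enclP hv; apply: hx0; exists (v - x0); last by rewrite addrC subrK.
  by move=> i; rewrite alphaB mulrBr subr_gt0; exact: lt_le_trans (mP i) (hv i).
- by exists xi => _ [v hv <-]; exact: enclD.
- exists [set H | exists i, H = halfspace D (simple b i) (- m%:Z)]; split.
  + by move=> H [i ->]; exists (simple b i), (- m%:Z); split; [exact: Delta_simple|left].
  + exists [set: V]; split; first by split=> //; exact: openT.
    move=> _ [_ [v hv <-]] H [i ->]; have /enclP/(_ i) := enclD _ _ hxi hv.
    by rewrite /halfspace /= root_form_simple mulrNz subr_ge0.
  + move=> v hv; apply/enclP => i; have := hv _ (ex_intro _ i erefl).
    by rewrite /halfspace /= root_form_simple mulrNz subr_ge0.
Qed.

Lemma sect_cl b S : sect b S -> cl D (sect b) S.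
Proof. by move=> /sect_encl [k [xi [_ kS hk _ _]]]; exists k. Qed.

(** This brings the two infinities under MA3 and MA4. The shortening is by the tip [xi] of an
    enclosed subsector; conversely a point of the base chamber, translated by the cone, gives a
    sector. *)
Lemma sect_chimney b : sect b = chimney_germ D 0 (cone b) (cone b).
Proof.
apply/seteqP; split=> S.
  move=> /sect_encl [k [xi [hxi kS _ hl hD]]].
  exists xi; first exact: subset_closure.
  exists k; split=> //; exists (encl k); first by rewrite add0r.
  by move=> u v; exact: hD.
move=> [xi _ [k [[A hA hAk] kS]]].
have [t0 t00 ht0] := lface_ray (cone_unit_dir b) hA.
have hx := ht0 t0; rewrite t00 lexx in hx.
by exists (0 + xi + t0 *: unit_dir b) => _ [v hv <-]; apply/kS/hAk => //; exact: hx.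
Qed.

Lemma spherical_cone b : spherical_vface D (cone b).
Proof.
have int v : cone false v -> interior (tits D) v.
  move=> hv; apply: (@filterS _ (nbhs v) _ (cone false)).
    move=> u hu; exists id; split; first exact: weyl_id.
    by rewrite image_id -cone_false; exact: subset_closure.
  have H i : \forall u \near v, 0 < (-1) ^+ false * alpha i u.
    have cont : alpha i @ v --> alpha i v by exact: alpha_continuous.
    have : nbhs (alpha i v) [set r | 0 < r].
      by apply: open_nbhs_nbhs; split; [exact: open_gt|have := hv i; rewrite mul1r].
    move=> /cont h; have : nbhs v (alpha i @^-1` [set r | 0 < r]) := h.
    by apply: filterS => u; rewrite /= mul1r.
  exact: filter_forall (nbhs_filter v) H.
case: b; last first.
  exists (unit_dir false); split; first exact: cone_unit_dir.
  by left; apply: int; exact: cone_unit_dir.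
exists (unit_dir true); split; first exact: cone_unit_dir.
right; exists (- unit_dir true); last exact: opprK.
by apply: int => i; have := cone_unit_dir true i; rewrite alphaN mul1r expr1 mulN1r.
Qed.

(** An affine subspace containing the chimney contains the lines joining [a + f] to nearby points in
    all directions, so it is the whole space, and only the identity fixes all directions. *)
Lemma solid_cone b x Fv : Fv !=set0 -> solid D x (cone b) Fv.
Proof.
move=> [f hf].
have supp v : Defs.support (chimney D x (cone b) Fv) v.
  move=> E hE [k [[A hA hAk] kE]].
  have [a ha] := lface_cone_absorbing hA.
  have [s s0 hs] := ha (v - (a + f)).
  have [r r0 hr] := ha 0.
  rewrite scaler0 addr0 in hr.
  have := hE (a + f) (a + s *: (v - (a + f)) + f) s^-1 (kE _ (hAk _ _ hr hf)) (kE _ (hAk _ _ hs hf)).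
  rewrite [a + _ *: _ + f]addrAC [X in X - (a + f)]addrC addrK scalerA.
  by rewrite mulVf ?gt_eqF // scale1r addrC subrK.
apply: (@sub_finite_set _ _ [set id]); last exact: finite_set1.
move=> w [_ hw]; apply/funext => d; apply: hw; exists 0, d; split; rewrite ?subr0 //; exact: supp.
Qed.

(** Enclosures are cut out by closed half-spaces, so they also catch [z], the limit of the points
    [z + t *: d]. The shortening [xi] is invisible to the roots. *)
Lemma chimney_germ_ray b z d S : cone b d -> chimney_germ D z (cone b) V0 S ->
  exists2 t0 : R, 0 < t0 & forall t, 0 <= t <= t0 -> S (z + t *: d).
Proof.
move=> hd [xi /closure_V0 hxi [k [[A hA hAk] kS]]].
have [t0 t00 ht0] := lface_ray hd hA; exists t0 => // t /andP[t_ge0 tt0].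
apply: kS => c hc; case kc: (k c) => [k'|//]; rewrite /= /halfspace /=.
have ineq s : 0 < s <= t0 -> 0 <= root_form D c z + s * root_form D c d + k'%:~R.
  move=> hs; have := hAk _ _ (ht0 s hs) V0_0; rewrite addr0 => /(_ c hc).
  by rewrite kc /= /halfspace /= !root_formD root_formZ (root_form_eq0 c hxi) addr0.
rewrite root_formD root_formZ; move: t_ge0; rewrite le_eqVlt => /orP[/eqP <-|t_gt0].
  rewrite mul0r addr0 leNgt; apply/negP => hneg.
  set L := root_form D c d in ineq; set a := root_form D c z + _ in hneg.
  (* Small enough for the affine function [a + s * L], negative at 0, to be still negative at
     [s]. *)
  pose s := Num.min t0 (- a / (2 * (`|L| + 1))).
  have s0 : 0 < s by rewrite lt_min t00 divr_gt0 ?oppr_gt0 // mulr_gt0 // ltr_wpDl.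
  have := ineq s; rewrite s0 ge_min lexx => /(_ isT).
  have sa : s * (2 * (`|L| + 1)) <= - a.
    by rewrite -ler_pdivlMr ?mulr_gt0 ?ltr_wpDl // ge_min lexx orbT.
  have := ler_norm L; rewrite /a in sa hneg *.
  by nra.
by apply: ineq; rewrite t_gt0.
Qed.

(** A root bounded below on a sector cannot be negative in a direction of its closed cone, so moving
    along [d] leaves none of the half-spaces. *)
Lemma encl_ccone b k x d : encl k x -> sect b (encl k) -> ccone b d -> encl k (x + d).
Proof.
move=> hx [y hy] hd c hc; case kc: (k c) => [k'|//]; rewrite /= /halfspace /= root_formD.
have := hx c hc; rewrite kc /= /halfspace /= => h0.
suff : 0 <= root_form D c d by move=> h1; rewrite addrAC addr_ge0.
rewrite leNgt; apply/negP => hneg.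
have ineq t : 0 < t -> 0 <= root_form D c (y + unit_dir b) + t * root_form D c d + k'%:~R.
  move=> t0; have : encl k (y + (unit_dir b + t *: d)).
    apply: hy; exists (unit_dir b + t *: d) => //; apply: coneDc (cone_unit_dir b) _ => i.
    by rewrite alphaZ mulrCA mulr_ge0 // ltW.
  by move/(_ c hc); rewrite kc /= /halfspace /= !root_formD root_formZ addrA.
set L := root_form D c d in hneg ineq; set a := root_form D c (y + _) in ineq.
clear kc hx h0.
(* At this parameter the term in [L] equals minus [|a + k'| + 1], which makes the sum negative. *)
have := ineq ((`|a + k'%:~R| + 1) / - L); rewrite divr_gt0 ?oppr_gt0 ?ltr_wpDl // => /(_ isT).
have -> : (`|a + k'%:~R| + 1) / - L * L = - (`|a + k'%:~R| + 1).
  by field; rewrite lt_eqF.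
have := ler_norm (a + k'%:~R); lra.
Qed.

End Cones.

(** * Charts agreeing with the fundamental one at an infinity *)

Section Charts.
Context (R : realType) (I : finType) (n : nat) (D : root_generating_system I n).
Local Notation V := 'rV[R]_n.
Local Notation V0 := (Fvf D finset.setT : set V).
Local Notation cone := (@cone R I n D).
Local Notation ccone := (@ccone R I n D).
Local Notation unit_dir := (@unit_dir R I n D).
Local Notation sect := (@sect R I n D).
Local Notation encl := (@encl R I n D).
Context (T : Type) (M : masure_data R n T) (hM : is_masure D M).
Implicit Types (A B : set T) (f g : V -> T) (u v d x z : V) (b : bool).

Lemma chart_bij A f : apt_chart M A f -> set_bij [set: V] A f.
Proof. by move=> [hA hf]; have [_ + _] := masure_MA1 hM hA; apply. Qed.

Lemma chart_inj A f : apt_chart M A f -> injective f.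
Proof. by move=> /chart_bij [_ h _] u v; apply: h; rewrite in_setE. Qed.

Lemma chart_mem A f v : apt_chart M A f -> A (f v).
Proof. by move=> /chart_bij [h _ _]; apply: h. Qed.

Lemma chart_surj A f y : apt_chart M A f -> A y -> exists v, f v = y.
Proof. by move=> /chart_bij [_ _ h] /h [v _ <-]; exists v. Qed.

Lemma chart_affine A f g : apt_chart M A f -> apt_chart M A g ->
  exists w q, [/\ weyl D w & forall v, g v = f (w v + q)].
Proof.
move=> [hA hf] [_ hg]; have [_ _ /(_ f g hf) [/(_ hg) [_ [w [q [hw _ ->]]] ->] _]] := masure_MA1 hM hA.
by exists w, q.
Qed.

Lemma chart_comp A f (w : V -> V) : apt_chart M A f -> weyl D w -> apt_chart M A (f \o w).
Proof.
move=> [hA hf] hw; split=> //; have [_ _ /(_ f (f \o w) hf) [_ H]] := masure_MA1 hM hA.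
apply: H; exists w => //; exists w, 0; split=> //.
  by exists (fun=> 0); rewrite big1 // => i _; rewrite scale0r.
by apply/funext => v; rewrite addr0.
Qed.

Lemma apt_has_chart A : apt M A -> exists f, apt_chart M A f.
Proof. by move=> hA; have [[f hf] _ _] := masure_MA1 hM hA; exists f. Qed.

Lemma isom_chart A B f (phi : T -> T) : apt_chart M A f -> apt M B -> apt_isom M A B phi ->
  apt_chart M B (phi \o f).
Proof. by move=> hf hB [_ h]; split=> //; apply/h; [exact: chart_bij|exact: hf.2]. Qed.

Lemma isom_pull A B g (phi : T -> T) : apt M A -> apt_isom M A B phi -> apt_chart M B g ->
  exists2 f, apt_chart M A f & forall v, phi (f v) = g v.
Proof.
move=> hA hphi hg; have [f hf] := apt_has_chart hA.
have [hB gB] := hg; have [_ fB] := isom_chart hf hB hphi.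
have [_ _ /(_ _ g fB) [/(_ gB) [w hw ->] _]] := masure_MA1 hM hB.
exists (f \o w) => //; split=> //; have [_ _ /(_ _ (f \o w) hf.2) [_ H]] := masure_MA1 hM hA.
by apply: H; exists w.
Qed.

Lemma chart_isom A B f g : apt_chart M A f -> apt_chart M B g ->
  exists2 phi, apt_isom M A B phi & forall v, phi (f v) = g v.
Proof.
(* The default 0 is reached only outside [A], where the values of [phi] are irrelevant. *)
move=> hf hg; pose phi y := g (xget 0 [set v | f v = y]).
have phiE v : phi (f v) = g v.
  rewrite /phi; case: xgetP => [u _ /(chart_inj hf) -> //|/(_ v)].
  by rewrite /mkset => /(_ erefl).
exists phi => //; split.
  split.
  - by move=> _ /(chart_surj hf) [v <-]; rewrite phiE; exact: chart_mem hg.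
  - move=> y y'; rewrite !in_setE => /(chart_surj hf) [v <-] /(chart_surj hf) [v' <-].
    by rewrite !phiE => /(chart_inj hg) ->.
  - by move=> _ /(chart_surj hg) [v <-]; exists (f v); [exact: chart_mem hf|exact: phiE].
have [hA fA] := hf; have [hB gB] := hg.
have [_ _ /(_ f _ fA) HA] := masure_MA1 hM hA.
have [_ _ /(_ g _ gB) HB] := masure_MA1 hM hB.
move=> h [hhA _ _]; rewrite HA HB; split=> [[w hw ->]|[w hw hphi]]; exists w => //.
  by apply/funext => v /=; rewrite phiE.
apply/funext => v /=; have [u hu] := chart_surj hf (hhA v Logic.I).
have := congr1 (fun k => k v) hphi; rewrite /= -hu phiE.
by move=> /(chart_inj hg) ->.
Qed.

Context (iota : V -> T) (hiota : apt_chart M (range iota) iota).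

(* Charts agreeing with the fundamental one towards the infinity of sign b. *)
Definition echart b A g := apt_chart M A g /\ sect b [set v | g v = iota v].

Lemma echart_iota b : echart b (range iota) iota.
Proof. by split=> //; exists 0. Qed.

Lemma echart_mem b A g : echart b A g -> fmap iota (sect b) A.
Proof. by move=> [hg]; apply: sectS => v /= <-; exact: chart_mem hg. Qed.

Lemma fmap_sect_splayed b : splayed_germ D M (fmap iota (sect b)).
Proof.
exists (range iota), iota, 0, (cone b), (cone b); split=> //.
- exact: vface_cone.
- exact: vface_cone.
- exact: spherical_cone.
- by rewrite sect_chimney.
Qed.

Lemma fmap_sect_solid b : face_or_solid_germ D M (fmap iota (sect b)).
Proof.
exists (range iota), iota; split=> //; right; exists 0, (cone b), (cone b); split.
- exact: vface_cone.
- exact: vface_cone.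
- by apply: solid_cone; exists (unit_dir b); exact: cone_unit_dir.
- by rewrite sect_chimney.
Qed.

Lemma echart_pull b A g S : echart b A g -> pull g (fmap iota (sect b)) S <-> sect b S.
Proof.
move=> [hg hgs]; split=> hS.
  apply: sectS (sectI hgs hS) => v [/= <- [u Su]].
  by move=> /(chart_inj hg) <-.
apply: sectS (sectI hgs hS) => v [/= <- Sv]; by exists v.
Qed.

Lemma echart_exists b B : apt M B -> fmap iota (sect b) B -> exists g, echart b B g.
Proof.
move=> hB hBe.
have [phi hphi] : exists2 phi, apt_isom M (range iota) B phi &
    fixes (range iota) phi (cl_union D iota (fmap iota (sect b)) (fmap iota (sect b))).
  apply: (masure_MA4 hM); split=> //; [exact: fmap_sect_splayed|exact: fmap_sect_solid|].
  by split=> //; exact: (echart_mem (echart_iota b)).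
move=> [k [[hk _] hfix]]; exists (phi \o iota); split; first exact: isom_chart hphi.
have {}hk : sect b (encl k) by apply/(echart_pull _ (echart_iota b)).
by apply: sectS hk => v /hfix [_].
Qed.

(** The cone spans [V]: [v - x0] is a difference of two of its vectors, and a map fixing [x0] plus
    the cone fixes [x0] as well as every direction of the cone. *)
Lemma fix_cone_id b (w : V -> V) q : weyl D w -> sect b [set v | w v + q = v] ->
  forall v, w v + q = v.
Proof.
move=> hw [x0 hx0] v; have [t t0 ht] := cone_absorb D b (v - x0).
set y := t *: _ in ht; have ydir : cone b y by apply: coneZ t0 _; exact: cone_unit_dir.
have hfix d : cone b d -> w x0 + w d + q = x0 + d.
  by move=> hd; rewrite -(weylD _ _ hw); apply: hx0; exists d.
(* Comparing the values at [y] and [2 y] separates the linear part from the translation. *)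
have h1 := hfix y ydir; have h2 := hfix (y + y) (coneD ydir ydir).
rewrite (weylD _ _ hw) in h2.
have wy : w y = y.
  apply: (@addrI _ (w x0 + w y + q)).
  by rewrite [in RHS]h1 -[RHS]addrA -h2 -!addrA [q + _]addrC.
have e1 : w x0 + q = x0 by apply: (addIr y); rewrite -h1 wy addrAC.
have h3 := hfix _ ht; set u := y + _ in h3.
have wu : w u = u by apply: (@addrI _ (w x0 + q)); rewrite addrAC h3 e1.
have -> : v = u - y + x0 by rewrite /u [y + _]addrC addrK subrK.
by rewrite (weylD _ _ hw) (weylB _ _ hw) wu wy -addrA e1.
Qed.

(** MA4, for the infinity and the face of direction [V0] at [u], gives an isomorphism [phi] fixing
    an enclosure of both. The charts [phi \o g] and [h] of [B] then differ by an affine Weyl element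
    fixing a sector, hence coincide, and the enclosure contains [u] plus the closed cone. *)
Lemma echart_agree b A B g h u v : echart b A g -> echart b B h -> g u = h v ->
  u = v /\ forall d, ccone b d -> g (u + d) = h (u + d).
Proof.
move=> hg hh guv; have [[hA gA] hgs] := hg; have [[hB hBh] hhs] := hh.
have BgU : B (g u) by rewrite guv; exact: chart_mem hh.1.
(* MA4 requires [B] to contain the face and not only the point; MA2 for the point provides this. *)
have [k [ku hkB]] : exists k, encl k u /\ encl k `<=` g @^-1` (A `&` B).
  have hyp : ma2_hyp D M A B g (globally [set u]).
    split=> //; first by apply: Or41; exists u.
    by move=> _ ->.
  have [[k [ku kS]] _] := masure_MA2 hM hyp.
  by exists k; split=> //; exact: ku.
pose F := fmap g (lface D u V0).
have [phi hphi] : exists2 phi, apt_isom M A B phi &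
    fixes A phi (cl_union D g (fmap iota (sect b)) F).
  apply: (masure_MA4 hM); split=> //; first exact: fmap_sect_splayed.
    exists A, g; split=> //; left; exists (lface D u V0) => //.
    by exists u, V0; split=> //; exact: vface_V0.
  split; [exact: echart_mem hg| |exact: echart_mem hh|].
    apply: lfaceS (encl_lface_V0 ku) => w hw; exact: chart_mem hg.1.
  by apply: lfaceS (encl_lface_V0 ku) => w /hkB [].
move=> [k' [[hk1 hk2] hfix]].
have {}hk1 : sect b (encl k') by apply/(echart_pull _ hg).
have {}hk2 : encl k' u.
  have [w hw hwu] := lface_V0_mem hk2.
  by rewrite -(chart_inj hg.1 hwu).
have gphi w : encl k' w -> phi (g w) = g w by move=> /hfix [].
have hg' : apt_chart M B (phi \o g) := isom_chart hg.1 hB hphi.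
have [w [q [hw hwq]]] := chart_affine hg' hh.1.
have hE : forall v, w v + q = v.
  apply: (fix_cone_id hw (b := b)); apply: sectS (sectI (sectI hgs hhs) hk1).
  move=> y [[/= gy hy] ky]; apply: (chart_inj hg').
  by rewrite -hwq hy -gy /= gphi.
have hgE y : encl k' y -> h y = g y by move=> ky; rewrite hwq hE /= gphi.
split; first by apply: (chart_inj hh.1); rewrite -guv hgE.
by move=> d hd; rewrite hgE //; exact: encl_ccone hd.
Qed.

Lemma retraction_echart b A g v : echart b A g -> retraction M iota (sect b) (g v) = v.
Proof.
move=> hg; rewrite /retraction; case: xgetP => [z _|/(_ v)].
  move=> [B [phi [hB Bgv hBe hphi [hfix hz]]]].
  have [f hf hfE] := isom_pull hB hphi hiota.
  have inj := proj1 hphi; have {}inj : {in B &, injective phi} by case: inj.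
  have hh : echart b B f.
    split=> //; apply: sectS hfix => u [/= Bu pu]; apply: inj; rewrite ?in_setE //.
      exact: chart_mem hf.
    by rewrite hfE pu.
  have : g v = f z.
    by apply: inj; rewrite ?in_setE ?hfE //; exact: chart_mem hf.
  by move=> /(echart_agree hg hh) [].
move=> H; exfalso; apply: H.
have [phi hphi hE] := chart_isom hg.1 hiota.
exists A, phi; split=> //.
- exact: hg.1.1.
- exact: chart_mem hg.1.
- exact: echart_mem hg.
- split; last exact: hE.
  apply: sectS hg.2 => u /= gu; rewrite /= -gu; split; first exact: chart_mem hg.1.
  by rewrite hE.
Qed.

End Charts.

(** Real induction: the supremum of the points reached from [a] is reached by the left-hand
    hypothesis, and the right-hand one passes beyond it unless it is [b]. The hypotheses are
    one-sided because the axioms control a segment germ on one side of its base point. *)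
Lemma interval_chain (R : realType) (P : R -> R -> Prop) (a b : R) : a <= b ->
  (forall s, P s s) -> (forall r s t, P r s -> P s t -> P r t) ->
  (forall s, a <= s <= b -> exists2 e : R, 0 < e &
     forall t, 0 <= t <= e -> s + t <= b -> P s (s + t)) ->
  (forall s, a <= s <= b -> exists2 e : R, 0 < e &
     forall t, 0 <= t <= e -> a <= s - t -> P (s - t) s) ->
  P a b.
Proof.
move=> ab Prefl Ptrans Pr Pl.
pose S := [set s | a <= s <= b /\ P a s].
have Sa : S a by split=> //; rewrite lexx.
have Sub : ubound S b by move=> s [/andP[]].
have Ssup : has_sup S by split; [exists a|exists b].
have ac : a <= sup S by apply: ub_le_sup => //; exists b.
have cb : sup S <= b by apply: ge_sup => //; exists a.
have acb : a <= sup S <= b by rewrite ac.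
have Pac : P a (sup S).
  have [e e0 he] := Pl _ acb.
  have [s [/andP[sa sb] Ps] cs] := sup_adherent e0 Ssup.
  have sc : s <= sup S by apply: ub_le_sup; [exists b|split; rewrite // sa].
  apply: Ptrans Ps _; have := he (sup S - s); rewrite subKr; apply=> //.
  by rewrite subr_ge0 sc lerBlDr -lerBlDl ltW.
move: cb; rewrite le_eqVlt => /orP[/eqP <- //|cb]; exfalso.
have [e e0 he] := Pr _ acb.
pose t := Num.min e (b - sup S).
have t0 : 0 < t by rewrite lt_min e0 subr_gt0.
have tb : sup S + t <= b by rewrite -lerBrDl ge_min lexx orbT.
have : S (sup S + t).
  split; first by rewrite tb andbT (le_trans ac) // lerDl ltW.
  by apply: Ptrans Pac _; apply: he => //; rewrite (ltW t0) ge_min lexx.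
move=> /(ub_le_sup (ex_intro _ b Sub)); rewrite gerDl => /(lt_le_trans t0).
by rewrite ltxx.
Qed.

(** * Retracted images of rays *)

Section Paths.
Context (R : realType) (I : finType) (n : nat) (D : root_generating_system I n).
Local Notation V := 'rV[R]_n.
Local Notation V0 := (Fvf D finset.setT : set V).
Local Notation alpha := (@alpha R I n D).
Local Notation cone := (@cone R I n D).
Local Notation ccone := (@ccone R I n D).
Local Notation unit_dir := (@unit_dir R I n D).
Local Notation sect := (@sect R I n D).
Local Notation Qpos := (@Qvee_pos R I n D).
Context (T : Type) (M : masure_data R n T) (hM : is_masure D M).
Context (iota : V -> T) (hiota : apt_chart M (range iota) iota).
Local Notation echart := (@echart R I n D T M iota).
Implicit Types (A B : set T) (f g : V -> T) (u v d x z nu : V) (b : bool).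

Lemma echart_through b y : exists A g v, echart b A g /\ g v = y.
Proof.
have [A hA Ay] := masure_cover hM y.
have [f hf] := apt_has_chart hM hA; have [v0 fv0] := chart_surj hM hf Ay.
have face_v0 : face_or_solid_germ D M (fmap f (lface D v0 V0)).
  exists A, f; split=> //; left; exists (lface D v0 V0) => //.
  by exists v0, V0; split=> //; exact: vface_V0.
have [B hB [Be Bf]] := masure_MA3 hM (fmap_sect_splayed D hiota b) face_v0.
have [g hg] := echart_exists hM hiota hB Be.
have [v hv] : exists v, g v = y.
  by apply: (chart_surj hM hg.1); rewrite -fv0; exact: (lface_V0_mem Bf).
by exists B, g, v.
Qed.

Lemma tits_cone d : cone false d -> tits D d.
Proof.
move=> hd; exists id; split; first exact: weyl_id.
by rewrite image_id -cone_false; exact: subset_closure.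
Qed.

(** The isomorphism given by MA2 for a preordered segment germ turns [f] into a chart of [B], which
    differs from [g] by an affine Weyl element; [w] is its linear part. *)
Lemma chart_straight b A B f g z d (t0 : R) : apt_chart M A f -> apt_chart M B g ->
  cone b d -> 0 < t0 -> (forall t, 0 <= t <= t0 -> B (f (z + t *: d))) ->
  exists w u (t1 : R), [/\ weyl D w, 0 < t1, t1 <= t0 &
    forall t, 0 <= t <= t1 -> f (z + t *: d) = g (u + t *: w d)].
Proof.
move=> hf hg hd t00 hB; pose F := germ z (segment z (z + t0 *: d)).
have ord : vle D z (z + t0 *: d) \/ vle D (z + t0 *: d) z.
  rewrite /vle opprD addrA subrr add0r addrAC subrr add0r.
  move: (t0 *: d) (coneZ t00 hd) => d'; case: (b) => hd'; [right|left]; apply: tits_cone => //.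
  by move=> i; have := hd' i; rewrite alphaN mul1r expr1 mulN1r.
have hyp : ma2_hyp D M A B f F.
  split=> //; [exact: hg.1|by apply: Or42; exists z, (z + t0 *: d)|].
  apply: nearW => y [s [/andP[s0 s1] ->]].
  rewrite addrAC subrr add0r scalerA; apply: hB.
  by rewrite mulr_ge0 ?(ltW t00) // ler_piMl // ltW.
have [_ [phi hphi [k [hk hfix]]]] := masure_MA2 hM hyp.
have [w [q [hw hwq]]] := chart_affine hM hg (isom_chart hM hf hg.1 hphi).
have {}hk : nbhs z [set y | segment z (z + t0 *: d) y -> encl D k y] := hk.
have [t1 t10 ht1] := nbhs_line d hk.
exists w, (w z + q), (Num.min t0 t1); split=> //; first by rewrite lt_min t00.
  by rewrite ge_min lexx.
move=> t; rewrite le_min => /and3P[t_ge0 tt0 tt1].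
have : encl D k (z + t *: d).
  apply: ht1; first by rewrite t_ge0.
  exists (t / t0); split; first by rewrite divr_ge0 ?(ltW t00) // ler_pdivrMr // mul1r.
  by rewrite addrAC subrr add0r scalerA divfK // gt_eqF.
move=> /hfix [_ /= <-]; have /= -> := hwq (z + t *: d).
by rewrite (weylD _ _ hw) (weylZ _ _ hw) addrAC.
Qed.

(* The chamber germ is taken as the chimney whose direction is the minimal
   vectorial face, so that an apartment containing it contains z as well. *)
Lemma echart_straight b b' A f z d : apt_chart M A f -> cone b d ->
  exists B g w u (t1 : R), [/\ echart b' B g, weyl D w, 0 < t1 &
    forall t, 0 <= t <= t1 -> f (z + t *: d) = g (u + t *: w d)].
Proof.
move=> hf hd.
have hF : face_or_solid_germ D M (fmap f (chimney_germ D z (cone b) V0)).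
  exists A, f; split=> //; right; exists z, (cone b), V0; split=> //.
  - exact: vface_cone.
  - exact: vface_V0.
  - by apply: solid_cone; exists 0; exact: V0_0.
have [B hB [Be Bf]] := masure_MA3 hM (fmap_sect_splayed D hiota b') hF.
have [g hg] := echart_exists hM hiota hB Be.
have [t0 t00 ht0] := chimney_germ_ray hd Bf.
have [w [u [t1 [hw t10 _ H]]]] := chart_straight hf hg.1 hd t00 ht0.
by exists B, g, w, u, t1.
Qed.

Local Notation rho := (retraction M iota (sect true)).

(** The defect is additive over consecutive intervals and, on a short one, is [t] times
    [nu - w (w' nu)]. The extra [w] costs nothing, as [w \o w'] is again in the Weyl group; it
    allows a displacement in direction [w'' nu] to be turned back to [nu] before the comparison. *)
Lemma retraction_path A f z nu (s s' : R) : apt_chart M A f -> cone false nu -> s <= s' ->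
  forall w, weyl D w ->
  Qpos ((s' - s) *: nu - w (rho (f (z + s' *: nu)) - rho (f (z + s *: nu)))).
Proof.
move=> hf hnu ss' w hw; pose p r := rho (f (z + r *: nu)).
have split r r' : (r' - r) *: nu - w (p r' - p r) =
    (r' *: nu - w (p r')) - (r *: nu - w (p r)).
  by rewrite (weylB _ _ hw) scalerBl !opprB addrACA [RHS]addrACA; congr (_ + _); rewrite addrC.
pose P (r r' : R) := Qpos ((r' - r) *: nu - w (p r' - p r)).
have dom i : 0 <= alpha i nu by have := hnu i; rewrite mul1r => /ltW.
apply: (@interval_chain R P) ss' _ _ _ _ => [r|r1 r2 r3|r _|r _].
- by rewrite /P !subrr scale0r (weyl0 hw) subrr; exact: Qpos0.
- by rewrite /P !split => h1 h2; have := QposD h2 h1; rewrite addrA subrK.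
- have [B [g [w' [u [t1 [hg hw' t10 H]]]]]] := echart_straight true (z + r *: nu) hf hnu.
  exists t1 => // t ht _; rewrite /P /p.
  have e0 : f (z + r *: nu) = g u.
    by have := H 0; rewrite lexx (ltW t10) !scale0r !addr0 => ->.
  rewrite addrAC subrr add0r scalerDl addrA (H t ht) e0 !(retraction_echart hM hiota _ hg).
  rewrite addrAC subrr add0r (weylZ _ _ hw) -scalerBr.
  have /andP[t0 _] := ht; apply: QposZ => //.
  exact: dominant_sub_weyl (weyl_comp hw hw') dom.
- have hd := @cone_sign R I n D true nu hnu; rewrite expr1 scaleN1r in hd.
  have [B [g [w' [u [t1 [hg hw' t10 H]]]]]] := echart_straight true (z + r *: nu) hf hd.
  exists t1 => // t ht _; rewrite /P /p.
  have e0 : f (z + r *: nu) = g u.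
    by have := H 0; rewrite lexx (ltW t10) !scale0r !addr0 => ->.
  rewrite subKr scalerBl addrA -scalerN (H t ht) e0 !(retraction_echart hM hiota _ hg).
  rewrite opprD addrA subrr add0r (weylN _ hw') scalerN opprK (weylZ _ _ hw) -scalerBr.
  have /andP[t0 _] := ht; apply: QposZ => //.
  exact: dominant_sub_weyl (weyl_comp hw hw') dom.
Qed.

End Paths.

(** * Computation of the vectorial distance *)

Section VectorialDistance.
Context (R : realType) (I : finType) (n : nat) (D : root_generating_system I n).
Local Notation V := 'rV[R]_n.
Local Notation alpha := (@alpha R I n D).
Local Notation cone := (@cone R I n D).
Local Notation ccone := (@ccone R I n D).
Local Notation sect := (@sect R I n D).
Local Notation Qpos := (@Qvee_pos R I n D).
Implicit Types (u v lam : V).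

Lemma closure_Cvf_dominant v : closure (Cvf D) v -> forall i, 0 <= alpha i v.
Proof.
move=> hv i; rewrite leNgt; apply/negP => hi.
have h : nbhs v (alpha i @^-1` [set r | r < 0]).
  apply: (alpha_continuous (x := v)); apply: open_nbhs_nbhs; split=> //; exact: open_lt.
by have [u [hu /= /(lt_trans (hu i))]] := hv _ h; rewrite ltxx.
Qed.

Lemma pp_weyl (w : V -> V) lam : weyl D w -> cone false lam -> pp D (w lam) = lam.
Proof.
move=> hw hlam; have dom i : 0 <= alpha i lam by have := hlam i; rewrite mul1r => /ltW.
rewrite /pp; case: xgetP => [l _ [/closure_Cvf_dominant hl [w' [hw' hl']]]|/(_ lam) H].
  rewrite hl' in hl *; exact: (dominant_orbit_unique (weyl_comp hw' hw) dom hl).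
exfalso; apply: H; split; first by rewrite -cone_false; exact: subset_closure.
by have [w' [hw' ww' _]] := weyl_inv hw; exists w'; rewrite ww'.
Qed.

Context (T : Type) (M : masure_data R n T) (hM : is_masure D M).
Context (G : set (T -> T)) (hG : strongly_transitive D M G).
Context (iota : V -> T) (hiota : apt_chart M (range iota) iota).

(** Automorphisms transport charts up to the Weyl group extended by all of [Y]. The linear part is
    absorbed into the chart; the translation [q] remains, as it need not come from the coroot
    lattice. *)
Lemma transported_chart k : G k ->
  exists f q, apt_chart M (k @` range iota) f /\ forall v, k (iota v) = f (v + q).
Proof.
move=> Gk; have [_ hapt hk] := st_automorphism hG Gk.
have [f [w [hf [w1 [y [hw1 ->]]] hE]]] := hk _ _ hiota.
have {}hf : apt_chart M (k @` range iota) f by split=> //; exact: (proj1 (hapt _) hiota.1).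
have [w' [hw' _ ww']] := weyl_inv hw1.
exists (f \o w1), (w' (ofY R y)); split; first exact: (chart_comp hM hf hw1).
move=> v; have /= := congr1 (fun h => h v) hE.
by rewrite (weylD _ _ hw1) ww'.
Qed.

(* The axiom MAO gives v - u = c w lam with c > 0; comparing both segments with
   their retractions, in either direction, gives c = 1. *)
Lemma segment_image k u v lam : G k -> cone false lam ->
  k (iota 0) = iota u -> k (iota lam) = iota v -> exists2 w, weyl D w & v - u = w lam.
Proof.
move=> Gk hlam ku kv.
have dom i : 0 <= alpha i lam by have := hlam i; rewrite mul1r => /ltW.
have [f [q [hf hfE]]] := transported_chart Gk.
have fq : f q = iota u by rewrite -ku hfE add0r.
have fql : f (q + lam) = iota v by rewrite -kv hfE addrC.
have eiota := echart_iota D hiota true.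
have path w : weyl D w -> Qpos (lam - w (v - u)).
  move=> hw; have := retraction_path hM hiota q hf hlam ler01 hw.
  by rewrite subr0 !scale1r scale0r addr0 fq fql !(retraction_echart hM hiota _ eiota).
have hle : vle D q (q + lam) by rewrite /vle addrAC subrr add0r; exact: tits_cone.
have seg := masure_MAO hM hf hiota fq fql hle.
(* MAO puts the transported segment in the fundamental apartment, but says nothing of how [s]
   depends on [t]. *)
have inA t : 0 <= t <= 1 -> exists s, [/\ 0 <= s, s <= 1 & f (q + t *: lam) = iota (u + s *: (v - u))].
  move=> ht; have : (f @` segment q (q + lam)) (f (q + t *: lam)).
    exists (q + t *: lam) => //; exists t; split=> //.
    by rewrite [q + lam]addrC addrK.
  rewrite seg => -[_ [s [/andP[s0 s1] ->]] <-]; by exists s.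
have inA' t : 0 <= t <= 1 -> (range iota) (f (q + t *: lam)).
  by move=> /inA [s [_ _ ->]]; exists (u + s *: (v - u)).
have [w [u0 [t1 [hw t10 t11 H]]]] := chart_straight hM hf hiota hlam ltr01 inA'.
have u0E : u0 = u.
  have := H 0; rewrite lexx (ltW t10) !scale0r !addr0 fq => /(_ isT).
  by move=> /(chart_inj hM hiota).
have [s [s0 s1]] := inA t1 (introT andP (conj (ltW t10) t11)).
rewrite H ?lexx ?ltW // u0E => /(chart_inj hM hiota) /addrI hs.
have [w' [hw' ww' w'w]] := weyl_inv hw.
(* The case [s = 0] forces [lam = 0], which lies in the cone when [I] is empty. *)
have [s00|sn0] := eqVneq s 0.
  have lam0 : lam = 0.
    move: hs; rewrite s00 scale0r => /eqP; rewrite scaler_eq0 gt_eqF //= => /eqP hs.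
    by rewrite -(ww' lam) hs (weyl0 hw').
  exists w => //; rewrite lam0 (weyl0 hw).
  by move: fql; rewrite lam0 addr0 fq => /(chart_inj hM hiota) ->; rewrite subrr.
have s_gt0 : 0 < s by rewrite lt_neqAle eq_sym sn0.
pose c := t1 / s; have c0 : 0 < c by rewrite divr_gt0.
have hc : v - u = c *: w lam.
  by rewrite /c mulrC -scalerA hs scalerA mulVf // scale1r.
have hvE : v = u + c *: w lam by rewrite -hc addrC subrK.
have Q1 : Qpos (lam - c *: lam).
  by have := path w' hw'; rewrite hc (weylZ _ _ hw') ww'.
(* For the reverse inequality, the inverse of [k] carries a segment of direction [c *: lam], read in
   [f3 \o w], to the one from [iota 0] to [iota lam]. *)
have [_ _ /(_ k Gk) [k' [Gk' kk' _]]] := st_group hG.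
have [f3 [q3 [hf3 hf3E]]] := transported_chart Gk'.
have hf4 := chart_comp hM hf3 hw.
pose z := w' (u + q3).
have e1 : (f3 \o w) (z + 0 *: lam) = iota 0.
  by rewrite scale0r addr0 /z /= w'w -hf3E -ku kk'.
have e2 : (f3 \o w) (z + c *: lam) = iota lam.
  rewrite /z /= (weylD _ _ hw) w'w (weylZ _ _ hw) addrAC -hvE -hf3E -kv kk' //.
have Q2 : Qpos (c *: lam - lam).
  have := retraction_path hM hiota z hf4 hlam (ltW c0) (weyl_id R D).
  by rewrite e1 e2 !(retraction_echart hM hiota _ eiota) !subr0.
have : lam - c *: lam = 0 by apply: (Qpos_pointed Q1); rewrite opprB.
move=> /eqP; rewrite subr_eq0 => /eqP clam.
by exists w => //; rewrite hc -(weylZ _ _ hw) -clam.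
Qed.

Lemma echart_induced B g : echart D M iota true B g ->
  exists2 h, G h & forall v, h (g v) = iota v.
Proof.
move=> hg; have [phi hphi hE] := chart_isom hM hg.1 hiota.
have hyp : ma4_hyp D M B (range iota) g (fmap iota (sect true)) (fmap iota (sect true)).
  split; [exact: hg.1|exact: hiota.1|exact: fmap_sect_splayed|exact: fmap_sect_solid|].
  have hB := echart_mem hM hg; have hA := echart_mem hM (echart_iota D hiota true).
  by split.
have hfix : fixes B phi (cl_union D g (fmap iota (sect true)) (fmap iota (sect true))).
  have [k [kS hk]] := sect_cl hg.2; exists k; split.
    have kg := proj2 (echart_pull hM (encl D k) hg) kS; by split.
  move=> v /hk /= gv; split; first exact: (chart_mem hM _ hg.1).
  by rewrite hE gv.
have [h Gh hh] := st_MA4 hG hyp hphi hfix.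
by exists h => // v; rewrite hh; [exact: hE|exact: (chart_mem hM _ hg.1)].
Qed.

(** An element [h] inducing the isomorphism to the fundamental apartment witnesses the value [lam];
    any other [k] is compared with it by applying [segment_image] to [k] after the inverse of
    [h]. *)
Lemma echart_Sv B g lam : echart D M iota true B g -> g 0 = iota 0 -> cone false lam ->
  Sv D M G iota (iota 0) lam (g lam).
Proof.
move=> hg g0 hlam; have [h Gh hh] := echart_induced hg.
split.
  exists B, g, 0, lam; split=> //; first exact: hg.1.
  by rewrite /vle subr0; exact: tits_cone.
have [_ Gcomp Ginv] := st_group hG.
rewrite /dv; case: xgetP => [_ _ [k [u [v [Gk ku kv ->]]]]|/(_ lam) H].
  have [h' [Gh' hh' h'h]] := Ginv h Gh.
  have [w hw ->] : exists2 w, weyl D w & v - u = w lam.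
    apply: (segment_image (Gcomp _ _ Gk Gh') hlam) => /=.
      by rewrite -(hh 0) hh' g0 ku.
    by rewrite -(hh lam) hh' kv.
  exact: pp_weyl.
exfalso; apply: H; exists h, 0, lam; split=> //; first by rewrite -[in LHS]g0 hh.
by rewrite subr0; exact/esym/(pp_weyl (weyl_id R D) hlam).
Qed.

End VectorialDistance.

(** * Comparison of the two retractions *)

Section Main.
Context (R : realType) (I : finType) (n : nat) (D : root_generating_system I n).
Local Notation V := 'rV[R]_n.
Local Notation alpha := (@alpha R I n D).
Local Notation cone := (@cone R I n D).
Local Notation ccone := (@ccone R I n D).
Local Notation sect := (@sect R I n D).
Local Notation Qpos := (@Qvee_pos R I n D).
Context (T : Type) (M : masure_data R n T) (hM : is_masure D M).
Context (iota : V -> T) (hiota : apt_chart M (range iota) iota).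
Local Notation rho_m := (rho_minfty D M iota).
Local Notation rho_p := (rho_pinfty D M iota).
Implicit Types (mu lam nu z u : V).

Lemma rho_mE : rho_m = retraction M iota (sect true).
Proof. by rewrite /rho_minfty -sect_true. Qed.

Lemma rho_pE : rho_p = retraction M iota (sect false).
Proof. by rewrite /rho_pinfty -sect_false. Qed.

(* x + R_+ nu is a ray towards +oo, so that it eventually enters the
   fundamental apartment. *)
Lemma ray_to_pinfty x : exists A f nu (L : R), [/\ apt_chart M A f, cone false nu, 0 <= L,
  f (rho_p x) = x & f (rho_p x + L *: nu) = iota (rho_p x + L *: nu)].
Proof.
have [A [f [v [hf fv]]]] := echart_through hM hiota false x.
have vE : rho_p x = v by rewrite rho_pE -fv (retraction_echart hM hiota _ hf).
have [x0 hx0] := hf.2.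
have [L L0 hL] := cone_absorb D false (v - x0).
exists A, f, (unit_dir R D false), L; split.
- exact: hf.1.
- exact: cone_unit_dir.
- exact: ltW.
- by rewrite vE.
- rewrite vE; apply: hx0; exists (L *: unit_dir R D false + (v - x0)) => //.
  by rewrite addrCA [x0 + _]addrC subrK addrC.
Qed.

Lemma rho_diff x lam mu : rho_p x = lam + mu -> rho_m x = lam -> Qvee_neg D mu.
Proof.
move=> hp hm; have [A [f [nu [L [hf hnu L0 f0 fL]]]]] := ray_to_pinfty x.
have := retraction_path hM hiota (rho_p x) hf hnu L0 (weyl_id R D).
rewrite scale0r addr0 f0 fL (retraction_echart hM hiota _ (echart_iota D hiota true)).
rewrite -rho_mE hm hp subr0 /= => h; rewrite /Qvee_neg /=; congr (Qpos _): h.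
by apply/rowP => k; rewrite !mxE; ring.
Qed.

(** Off-diagonal Cartan entries are nonpositive, so only the diagonal term [2 * c j] can contribute
    positively; the sum makes the bound uniform in [j]. *)
Lemma coroot_bound j (c m : I -> R) : (forall i, 0 <= c i) -> (forall i, c i <= m i) ->
  alpha j (\sum_i c i *: coroot R D i) <= 2 * \sum_i m i.
Proof.
move=> c0 cm; rewrite alpha_sum (bigD1 j) //= alphaZ alpha_coroot_diag.
have m0 i : 0 <= m i by exact: le_trans (c0 i) (cm i).
apply: (@le_trans _ _ (2 * m j)); last first.
  by rewrite ler_pM2l // (bigD1 j) //= lerDl sumr_ge0.
rewrite -[leRHS]addr0 lerD //; first by rewrite mulrC ler_pM2l.
apply: sumr_le0 => i ij; rewrite alphaZ alpha_coroot mulr_ge0_le0 //.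
by rewrite lerz0 gcm_offdiag.
Qed.

(* Going back along the ray from its point in the fundamental apartment, the
   retracted path stays dominant, so 0 remains in the sector towards -oo. *)
Lemma echart_at_origin x lam mu (m : I -> R) :
  rho_p x = lam + mu -> rho_m x = lam -> - mu = \sum_i m i *: coroot R D i ->
  (forall i, 2 * \sum_j m j <= alpha i lam) ->
  exists B g, [/\ echart D M iota true B g, g lam = x & g 0 = iota 0].
Proof.
move=> hp hm hmu hlam; have [A [f [nu [L [hf hnu L0 f0 fL]]]]] := ray_to_pinfty x.
pose z := rho_p x; pose p r := rho_m (f (z + r *: nu)).
have p0 : p 0 = lam by rewrite /p scale0r addr0 f0.
have pL : p L = lam + mu + L *: nu.
  by rewrite /p fL rho_mE (retraction_echart hM hiota _ (echart_iota D hiota true)) /z hp.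
have pQ r r' : r <= r' -> Qpos ((r' - r) *: nu - (p r' - p r)).
  move=> rr'; rewrite /p rho_mE.
  exact: (retraction_path hM hiota z hf hnu rr' (weyl_id R D)).
have pdom r i : 0 <= r <= L -> 0 <= alpha i (p r).
  move=> /andP[r0 rL]; have [c [c0 hc]] := pQ _ _ r0; have [c' [c'0 hc']] := pQ _ _ rL.
  (* The defects on [[0, r]] and [[r, L]] add up to [- mu]; freeness of the coroots turns this into
     an identity of coordinates, whence [c <= m]. *)
  have hcm : c =1 (fun i => m i - c' i).
    apply: (@coroot_inj R I n D); rewrite -hc.
    transitivity (- mu - ((L - r) *: nu - (p L - p r))).
      by rewrite p0 pL; apply/rowP => k; rewrite !mxE; ring.
    rewrite hmu hc' -sumrB; apply: eq_bigr => j _; by rewrite scalerBl.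
  have cm j : c j <= m j by rewrite hcm gerBl.
  have := coroot_bound i c0 cm; rewrite -hc !subr0 p0 !alphaB alphaZ.
  have := hnu i; rewrite mul1r => nu0; have := mulr_ge0 r0 (ltW nu0); have := hlam i; lra.
pose P r := exists B g, [/\ echart D M iota true B g, g (p r) = f (z + r *: nu) & g 0 = iota 0].
(* The chart known at [r'] and the chart [g], which sees both points, agree on the closed sector
   from [p r']; taking [d := - p r'], allowed since [p r'] is dominant, reaches the origin. *)
have transfer r r' B g u u' : 0 <= r' <= L -> echart D M iota true B g ->
    g u = f (z + r *: nu) -> g u' = f (z + r' *: nu) -> P r' -> P r.
  move=> hr' hg gu gu' [B' [h [hh hp' h0]]]; exists B, g.
  have pr : p r = u by rewrite /p -gu rho_mE (retraction_echart hM hiota _ hg).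
  have [_] := echart_agree hM hiota hh hg (etrans hp' (esym gu')).
  move=> /(_ (- p r')); rewrite subrr h0 pr => H; split=> //; apply/esym/H => i.
  by rewrite expr1 mulN1r alphaN opprK; exact: pdom.
have PL : P L.
  exists (range iota), iota; split=> //; first exact: echart_iota.
  by rewrite pL fL /z hp.
have [B [g [hg gx g0]]] : P 0.
  (* The chained relation is an implication from the later parameter to the earlier one, so the
     chain runs backwards from [L]. *)
  apply: (@interval_chain R (fun r r' => P r' -> P r) 0 L) PL => //.
  - by move=> r s t h1 h2 h3; apply/h1/h2.
  - move=> r hr.
    have [B [g [w [u [t1 [hg hw t10 H]]]]]] := echart_straight hM hiota true (z + r *: nu) hf hnu.
    exists t1 => // t ht tL; apply: (transfer r (r + t) B g u (u + t *: w nu)) => //.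
    + by rewrite tL andbT addr_ge0 //; [case/andP: hr|case/andP: ht].
    + by have := H 0; rewrite lexx (ltW t10) !scale0r !addr0 => ->.
    + by rewrite -H // scalerDl addrA.
  - move=> r hr; have hd := @cone_sign R I n D true nu hnu.
    rewrite expr1 scaleN1r in hd.
    have [B [g [w [u [t1 [hg hw t10 H]]]]]] := echart_straight hM hiota true (z + r *: nu) hf hd.
    exists t1 => // t ht tL; apply: (transfer (r - t) r B g (u + t *: w (- nu)) u) => //.
    + by rewrite -H // scalerBl scalerN addrA.
    + by have := H 0; rewrite lexx (ltW t10) !scale0r !addr0 => ->.
by exists B, g; split=> //; rewrite -p0 gx scale0r addr0.
Qed.

End Main.

Theorem theorem3p1 (R : realType) (I : finType) (n : nat)
    (D : root_generating_system I n) (T : Type) (M : masure_data R n T)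
    (G : set (T -> T)) (iota : 'rV[R]_n -> T)
    (hM : is_masure D M) (hthick : thick_finite_thickness D M)
    (hG : strongly_transitive D M G) (hiota : fundamental_apartment D M G iota)
    (mu : 'rV[R]_n) :
  (~ Qvee_neg D mu -> forall lam : 'rV[R]_n,
     rho_pinfty D M iota @^-1` [set lam + mu] `&`
     rho_minfty D M iota @^-1` [set lam] = set0) /\
  (Qvee_neg D mu -> exists m : R, forall lam : 'rV[R]_n,
     (forall i : I, m <= alpha D i lam) ->
     rho_pinfty D M iota @^-1` [set lam + mu] `&`
     rho_minfty D M iota @^-1` [set lam] `<=`
     Sv D M G iota (iota 0) lam `&` rho_pinfty D M iota @^-1` [set lam + mu]).
Proof.
have hchart := fund_chart hiota.
split=> [hmu lam|[m [m0 hm]]].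
  by apply/seteqP; split=> // x [hp hl]; apply: hmu; exact: (rho_diff hM hchart hp hl).
(* The sum is the bound of [coroot_bound]; the added 1 puts [lam] in the open cone, as [echart_Sv]
   requires. *)
exists (2 * \sum_i m i + 1) => lam hlam x [hp hl]; split=> //.
have hlam2 i : 2 * \sum_j m j <= alpha D i lam by apply: le_trans (hlam i); rewrite lerDl.
have [B [g [hg <- g0]]] := echart_at_origin hM hchart hp hl hm hlam2.
apply: (echart_Sv hM hG hchart hg g0) => i; rewrite mul1r; apply: lt_le_trans (hlam i).
by rewrite ltr_wpDl // mulr_ge0 // sumr_ge0.
Qed.
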